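(* Let $n\ge3$ and $s\in\{1,-1\}$, and consider on the graph $A_n$ the canonical quantum Riemannian geometry with metric parameters $h_1,\dots,h_{n-1}\in\mathbb{R}\setminus\{0\}$. There is a unique choice of $(h_1,\dots,h_{n-1})$ up to overall scale such that the Ricci scalar vanishes, $S=0$.
   Context: Let $q=e^{\imath\pi/(n+1)}$ and $(i)_q=\frac{q^i-q^{-i}}{q-q^{-1}}$. **Calculus.** $A_n$ is the graph with vertices $1,\dots,n$ and edges $i-(i+1)$, $1\le i\le n-1$. $A=\mathbb{C}(\{1,\dots,n\})$ is the algebra of complex functions on vertices, $\delta_i$ the Kronecker delta function at $i$. $\Omega^1$ has basis over $\mathbb{C}$ the arrows $a_i=\omega_{i\to i+1}$, $a_i'=\omega_{i+1\to i}$, $1\le i\le n-1$. It is an $A$-bimodule via $f a_i=f(i)a_i$, $a_i f=f(i+1)a_i$, $f a_i'=f(i+1)a_i'$, $a_i'f=f(i)a_i'$, with $\mathrm{d}f=\sum_i (f(i+1)-f(i))(a_i-a_i')$. $\Omega^1\otimes_A\Omega^1$ has basis the 2-step paths $a_i\otimes a_{i+1}$, $a_{i+1}'\otimes a_i'$, $a_i\otimes a_i'$, $a_i'\otimes a_i$ ($\otimes$ means $\otimes_A$). $\Omega^2$ is the quotient of $\Omega^1\otimes_A\Omega^1$ (quotient map $\wedge$) by $a_i\wedge a_{i+1}=0$, $a_{i+1}'\wedge a_i'=0$, $a_{i+1}\wedge a_{i+1}'+a_i'\wedge a_i=0$ ($1\le i\le n-2$), $a_1\wedge a_1'=0$, $a_{n-1}'\wedge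 a_{n-1}=0$. With $\theta=\sum_i(a_i+a_i')$, $\mathrm{d}:\Omega^1\to\Omega^2$ is $\mathrm{d}\omega=\theta\wedge\omega+\omega\wedge\theta$. **Canonical quantum Riemannian geometry.** The metric is $g=\sum_{i=1}^{n-1}h_i(\phi_i\,a_i\otimes a_i'+a_i'\otimes a_i)$ with $\phi_i=\frac{(i+1)_q}{(i)_q}$. The inverse metric is the bimodule map $(\ ,\ ):\Omega^1\otimes_A\Omega^1\to A$ with $(a_i,a_i')=\delta_i/h_i$, $(a_i',a_i)=\delta_{i+1}/(h_i\phi_i)$ and zero on the other 2-step paths. The connection is $\nabla:\Omega^1\to\Omega^1\otimes_A\Omega^1$, $\nabla\omega=\theta\otimes\omega-\sigma(\omega\otimes\theta)$, where $\sigma$ is the bimodule map with $\sigma(a_i\otimes a_{i+1})=\sigma_i\,a_i\otimes a_{i+1}$ ($1\le i\le n-2$); $\sigma(a_i'\otimes a_{i-1}')=\sigma_i'\,a_i'\otimes a_{i-1}'$ ($2\le i\le n-1$); $\sigma(a_1\otimes a_1')=\tau_1\,a_1\otimes a_1'$; $\sigma(a_i\otimes a_i')=\tau_i\,a_i\otimes a_i'+(1+\tau_i)\,a_{i-1}'\otimes a_{i-1}$ ($2\le i\le n-1$); $\sigma(a_i'\otimes a_i)=\tau_i'\,a_i'\otimes a_i+(1+\tau_i')\,a_{i+1}\otimes a_{i+1}'$ ($1\le i\le n-2$); $\sigma(a_{n-1}'\otimes a_{n-1})=\tau_{n-1}'\,a_{n-1}'\otimes a_{n-1}$, and $\tau_i=\frac{s(-1)^{i-1}}{(i)_q}$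 ($1\le i\le n$), $\tau_i'=-\tau_{i+1}$, $\sigma_i=\frac{h_{i+1}}{h_i}(1+\tau_{i+1})$, $\sigma_i'=\frac{h_{i-1}}{h_i}\frac1{1+\tau_i}$. **Curvature.** $R_\nabla=(\mathrm{d}\otimes\mathrm{id}-\mathrm{id}\wedge\nabla)\nabla:\Omega^1\to\Omega^2\otimes_A\Omega^1$. The lifting bimodule map $\iota:\Omega^2\to\Omega^1\otimes_A\Omega^1$ is $\iota(a_i\wedge a_i')=-\iota(a_{i-1}'\wedge a_{i-1})=\frac12(a_i\otimes a_i'-a_{i-1}'\otimes a_{i-1})$, $2\le i\le n-1$. Then $\mathrm{Ricci}=((\ ,\ )\otimes\mathrm{id}\otimes\mathrm{id})(\mathrm{id}\otimes\iota\otimes\mathrm{id})(\mathrm{id}\otimes R_\nabla)g\in\Omega^1\otimes_A\Omega^1$ and the Ricci scalar is $S=(\ ,\ )(\mathrm{Ricci})\in A$. *)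

(* Defs.v *)
From HB Require Import structures.
From mathcomp Require Import all_boot all_order all_algebra.
From mathcomp Require Import complex zify.
From mathcomp Require Import all_classical all_reals all_analysis.

Set Implicit Arguments.
Unset Strict Implicit.
Unset Printing Implicit Defensive.

Import Order.TTheory GRing.Theory Num.Theory.
Local Open Scope ring_scope.
Local Open Scope quotient_scope.

(* The quotient of a vector space V by a subspace U, on top of the additive
   quotient {quot _} of MathComp. *)
Section VectorQuotient.
Variables (K : fieldType) (V : vectType K) (U : {vspace V}).

Definition vquot : Type :=
  Quotient.quot (GRing.ZmodClosed.clone V (pred_of_vspace U) _).

HB.instance Definition _ := GRing.Zmodule.on vquot.

Definition vpi (x : V) : vquot := \pi_(Quotient.quot _) x.
Definition vrepr (x : vquot) : V :=
  repr (x : Quotient.quot (GRing.ZmodClosed.clone V (pred_of_vspace U) _)).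

Lemma vpiE x y : (vpi x = vpi y) <-> (x - y \in U).
Proof.
by rewrite /vpi; split => [/eqP|H]; last apply/eqP; rewrite -Quotient.idealrBE.
Qed.

Lemma vreprK x : vpi (vrepr x) = x.
Proof. exact: reprK. Qed.

Lemma vreprB x : vrepr (vpi x) - x \in U.
Proof. by apply/vpiE; rewrite vreprK. Qed.

Lemma vpiB : {morph vpi : x y / x - y}.
Proof. by move=> x y; rewrite /vpi raddfB. Qed.

Lemma vpiD : {morph vpi : x y / x + y}.
Proof. by move=> x y; rewrite /vpi raddfD. Qed.

Definition vscale (c : K) (x : vquot) : vquot := vpi (c *: vrepr x).

Lemma vscale_pi c x : vscale c (vpi x) = vpi (c *: x).
Proof. by apply/vpiE; rewrite -scalerBr memvZ ?vreprB. Qed.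

Let vind (P : vquot -> Prop) : (forall x, P (vpi x)) -> forall x, P x.
Proof. by move=> H x; rewrite -[x]vreprK. Qed.

Fact vscaleA a b v : vscale a (vscale b v) = vscale (a * b) v.
Proof. by elim/vind: v => v; rewrite !vscale_pi scalerA. Qed.
Fact vscale1 : left_id 1 vscale.
Proof. by elim/vind => v; rewrite vscale_pi scale1r. Qed.
Fact vscaleDr : right_distributive vscale +%R.
Proof.
move=> a; elim/vind => x; elim/vind => y.
by rewrite -vpiD !vscale_pi scalerDr vpiD.
Qed.
Fact vscaleDl v : {morph vscale^~ v : a b / a + b}.
Proof. by elim/vind: v => v a b; rewrite !vscale_pi scalerDl vpiD. Qed.

HB.instance Definition _ :=
  GRing.Zmodule_isLmodule.Build K vquot vscaleA vscale1 vscaleDr vscaleDl.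

Fact vpi_is_linear : linear vpi.
Proof. by move=> c x y; rewrite vpiD -vscale_pi. Qed.

HB.instance Definition _ := GRing.isLinear.Build K V vquot _ vpi vpi_is_linear.

End VectorQuotient.

Section LineGraph.
Variables (R : realType) (n : nat).
Local Notation C := R[i].
Local Open Scope complex_scope.

(* The vertices 1, ..., n are the elements of 'I_n; the ordinal x carries the
   label x.+1. *)
Definition label (x : 'I_n) : nat := x.+1.

Definition adj (x y : 'I_n) : bool :=
  (label y == (label x).+1) || (label x == (label y).+1).

(* k-step paths of the bidirected graph, as sequences of k+1 vertices. *)
Definition walk (k : nat) : Type := {p : k.+1.-tuple 'I_n | sorted adj p}.

HB.instance Definition _ k := Finite.on (walk k).

Definition labels k (p : walk k) : seq nat := map label (val p).

Lemma labels_inj k : injective (@labels k).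
Proof.
move=> p p' /(inj_map (fun x y : 'I_n => fun e => val_inj (succn_inj e))) e.
exact/val_inj/val_inj.
Qed.

(* The algebra of functions on the vertices. *)
Definition A : Type := {ffun 'I_n -> C^o}.

(* The k-fold tensor power of Omega^1 over A, given by coordinates in its basis
   of k-step paths; T 1 is Omega^1 itself. *)
Definition T (k : nat) : Type := {ffun walk k -> C^o}.

HB.instance Definition _ := Vector.on A.
HB.instance Definition _ k := Vector.on (T k).

Definition basis k (p : walk k) : T k := [ffun p' => (p' == p)%:R].

(* A path given by the labels of its vertices; this is 0 if there is no
   such path. *)
Definition path_of k (l : seq nat) : T k := [ffun p => (labels p == l)%:R].

Definition a (i : nat) : T 1 := path_of 1 [:: i; i.+1].
Definition a' (i : nat) : T 1 := path_of 1 [:: i.+1; i].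

Definition delta (i : nat) : A := [ffun x => (label x == i)%:R].

(* The two halves of a (k + l)-step path. *)
Fact wtake_subproof k l (p : walk (k + l)) :
  size (take k.+1 (val p)) == k.+1.
Proof. by rewrite size_takel // size_tuple ltnS leq_addr. Qed.

Fact wdrop_subproof k l (p : walk (k + l)) : size (drop k (val p)) == l.+1.
Proof. by rewrite size_drop size_tuple -addnS addKn. Qed.

Definition wtake k l (p : walk (k + l)) : walk k :=
  exist _ (Tuple (wtake_subproof p)) (take_sorted _ (valP p)).

Definition wdrop k l (p : walk (k + l)) : walk l :=
  exist _ (Tuple (wdrop_subproof p)) (drop_sorted _ (valP p)).

Definition lact k (f : A) (u : T k) : T k :=
  [ffun p => f (thead (val p)) * u p].

Definition ract k (u : T k) (f : A) : T k :=
  [ffun p => u p * f (tnth (val p) ord_max)].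

(* The tensor product over A, i.e. concatenation of paths; in particular
   basis p ⊗ basis p' = 0 unless p ends where p' starts. *)
Definition tens k l (u : T k) (v : T l) : T (k + l) :=
  [ffun p => u (wtake p) * v (wdrop p)].

Local Notation "u ⊗ v" := (tens u v) (at level 40, left associativity).

Lemma tens_balanced k l (u : T k) (f : A) (v : T l) :
  ract u f ⊗ v = u ⊗ lact f v.
Proof.
apply/ffunP => p; rewrite !ffunE -mulrA; congr (_ * (f _ * _)).
rewrite /thead !(tnth_nth (thead (val p))) /=.
by rewrite nth_take // nth_drop addn0.
Qed.

(* The linear map on the (k + l)-th tensor power with values
   e ⊗ e' |-> B e e' on the paths e ⊗ e'. *)
Definition lift2 k l (M : lmodType C) (B : T k -> T l -> M) (u : T (k + l)) : M :=
  \sum_(p : walk (k + l)) u p *: B (basis (wtake p)) (basis (wdrop p)).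

(* The linear map on T 2 with values
     a_i ⊗ a_(i+1)   |-> Fuu i,      a'_i ⊗ a'_(i-1) |-> Fdd i,
     a_i ⊗ a'_i      |-> Fud i,      a'_i ⊗ a_i      |-> Fdu i. *)
Definition ext2 (M : lmodType C) (Fuu Fdd Fud Fdu : nat -> M) (u : T 2) : M :=
  \sum_(p : walk 2) u p *:
    (if labels p is [:: x; y; z] then
       if (x < y)%N then (if (y < z)%N then Fuu x else Fud x)
       else (if (z < y)%N then Fdd y else Fdu y)
     else 0).

Lemma tens_arrow (x y z t : nat) :
  path_of 1 [:: x; y] ⊗ path_of 1 [:: z; t] =
  if z == y then path_of 2 [:: x; y; t] else 0.
Proof.
apply/ffunP => p; rewrite /tens !ffunE /labels /=.
rewrite (fun_if (fun f : T 2 => f p)) !ffunE /labels.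
have := size_tuple (val p).
case: (tval (val p)) => [|p1 [|p2 [|p3 [|]]]] //= _.
rewrite !eqseq_cons !eqxx !andbT -natrM mulnb.
case: (eqVneq z y) => [->|zy].
  by congr ((nat_of_bool _)%:R); case: (_ == y); rewrite ?andbF ?andbT.
case: (eqVneq (label p2) y) => [e|_]; last by rewrite andbF.
by rewrite e [y == z]eq_sym (negbTE zy) !andbF.
Qed.

Lemma ext2_path (M : lmodType C) (F1 F2 F3 F4 : nat -> M) (x y z : nat) :
  (0 < x <= n)%N -> (0 < y <= n)%N -> (0 < z <= n)%N ->
  (y == x.+1) || (x == y.+1) -> (z == y.+1) || (y == z.+1) ->
  ext2 F1 F2 F3 F4 (path_of 2 [:: x; y; z]) =
  if (x < y)%N then (if (y < z)%N then F1 x else F3 x)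
       else (if (z < y)%N then F2 y else F4 y).
Proof.
move=> /andP[]; case: x => // x _ hx /andP[]; case: y => // y _ hy /andP[].
case: z => // z _ hz xy yz.
have ok : sorted adj [tuple Ordinal hx; Ordinal hy; Ordinal hz].
  by rewrite /= /adj /label /= xy yz.
pose p : walk 2 := exist (fun t : 3.-tuple _ => sorted adj t) _ ok.
have lp : labels p = [:: x.+1; y.+1; z.+1] by [].
rewrite /ext2 (bigD1 p) //= big1 ?addr0 => [|p' pp'].
  by rewrite ffunE lp eqxx scale1r.
by rewrite ffunE -lp (inj_eq (@labels_inj _)) (negbTE pp') scale0r.
Qed.

Section Ext2.
Variables (M : lmodType C) (Fuu Fdd Fud Fdu : nat -> M).
Let E := ext2 Fuu Fdd Fud Fdu : T 2 -> M.

Lemma ext2_uu i : (1 <= i <= n - 2)%N -> E (a i ⊗ a i.+1) = Fuu i.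
Proof.
move=> H; rewrite tens_arrow eqxx [LHS]ext2_path; try lia.
by rewrite !ltnSn.
Qed.

Lemma ext2_dd i : (2 <= i <= n.-1)%N -> E (a' i ⊗ a' i.-1) = Fdd i.
Proof.
move=> H; rewrite tens_arrow prednK ?eqxx; last lia.
rewrite [LHS]ext2_path; try lia.
by rewrite ifF ?ifT //; lia.
Qed.

Lemma ext2_ud i : (1 <= i <= n.-1)%N -> E (a i ⊗ a' i) = Fud i.
Proof.
move=> H; rewrite tens_arrow eqxx [LHS]ext2_path; try lia.
by rewrite ltnSn ifF //; lia.
Qed.

Lemma ext2_du i : (1 <= i <= n.-1)%N -> E (a' i ⊗ a i) = Fdu i.
Proof.
move=> H; rewrite tens_arrow eqxx [LHS]ext2_path; try lia.
by rewrite ifF ?ifF //; lia.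
Qed.

Lemma ext2_linear : linear E.
Proof.
move=> c u v; rewrite /E /ext2 scaler_sumr -big_split; apply: eq_bigr => p _ /=.
by rewrite !ffunE scalerDl scalerA.
Qed.
End Ext2.

Definition theta : T 1 := \sum_(1 <= i < n) (a i + a' i).

(* The relations of Omega^2. *)
Definition rels : seq (T 2) :=
  [seq a i ⊗ a i.+1 | i <- iota 1 (n - 2)]
  ++ [seq a' i.+1 ⊗ a' i | i <- iota 1 (n - 2)]
  ++ [seq a i.+1 ⊗ a' i.+1 + a' i ⊗ a i | i <- iota 1 (n - 2)]
  ++ [:: a 1 ⊗ a' 1; a' n.-1 ⊗ a n.-1].

Definition arrows : seq (T 1) :=
  [seq a i | i <- iota 1 n.-1] ++ [seq a' i | i <- iota 1 n.-1].

(* Each relation x satisfies x = delta_i x delta_j for some i, j, so that the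
   linear span of the relations is already a sub-bimodule N of T 2. By right
   exactness, tensoring Omega^2 = T 2 / N with Omega^1 on the right (and then
   on the left) amounts to taking the quotient of T 3 (resp. T 4) by the
   products of N with Omega^1. *)
Definition rels_r : seq (T 3) := [seq @tens 2 1 r e | r <- rels, e <- arrows].
Definition rels_lr : seq (T 4) := [seq @tens 1 3 e r | e <- arrows, r <- rels_r].

Definition Omega2 : Type := vquot <<rels>>%VS.
(* Omega^2 ⊗ Omega^1 *)
Definition Omega21 : Type := vquot <<rels_r>>%VS.
(* Omega^1 ⊗ Omega^2 ⊗ Omega^1 *)
Definition Omega121 : Type := vquot <<rels_lr>>%VS.

HB.instance Definition _ := GRing.Lmodule.on Omega2.
HB.instance Definition _ := GRing.Lmodule.on Omega21.
HB.instance Definition _ := GRing.Lmodule.on Omega121.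

Definition wedge_map (u : T 2) : Omega2 := vpi <<rels>>%VS u.
Definition wedge (u v : T 1) : Omega2 := wedge_map (u ⊗ v).
(* Omega^1 x (Omega^1 ⊗ Omega^1) -> Omega^2 ⊗ Omega^1 *)
Definition wedge_id (u : T 1) (x : T 2) : Omega21 :=
  vpi <<rels_r>>%VS (@tens 1 2 u x).

Definition tens_2_1 (w : Omega2) (v : T 1) : Omega21 :=
  vpi <<rels_r>>%VS (@tens 2 1 (vrepr w) v).
Definition tens_1_21 (u : T 1) (x : Omega21) : Omega121 :=
  vpi <<rels_lr>>%VS (@tens 1 3 u (vrepr x)).

Definition d1 (w : T 1) : Omega2 := wedge theta w + wedge w theta.

(* q = exp(i pi / (n + 1)) and the q-integers (i)_q. *)
Definition q : C := cos (pi / n.+1%:R) +i* sin (pi / n.+1%:R).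
Definition qint (i : nat) : C := (q ^+ i - q ^- i) / (q - q^-1).

Section Geometry.
(* The metric parameters: h_i is the (i-1)-st entry of the tuple h. *)
Variables (s : C) (h : n.-1.-tuple R).

Definition hh (i : nat) : C := (nth 0 h i.-1)%:C.

Definition phi (i : nat) : C := qint i.+1 / qint i.
Definition tau (i : nat) : C := s * (-1) ^+ i.-1 / qint i.
Definition tau' (i : nat) : C := - tau i.+1.
Definition sig (i : nat) : C := hh i.+1 / hh i * (1 + tau i.+1).
Definition sig' (i : nat) : C := hh i.-1 / hh i * (1 + tau i)^-1.

Definition metric : T 2 :=
  \sum_(1 <= i < n) hh i *: (phi i *: (a i ⊗ a' i) + a' i ⊗ a i).

Definition pairing : T 2 -> A :=
  ext2 (fun=> 0) (fun=> 0)
    (fun i => (hh i)^-1 *: delta i)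
    (fun i => (hh i * phi i)^-1 *: delta i.+1).

Definition sigma : T 2 -> T 2 :=
  ext2
    (fun i => sig i *: (a i ⊗ a i.+1))
    (fun i => sig' i *: (a' i ⊗ a' i.-1))
    (fun i => if i == 1%N then tau i *: (a i ⊗ a' i)
              else tau i *: (a i ⊗ a' i) + (1 + tau i) *: (a' i.-1 ⊗ a i.-1))
    (fun i => if i == n.-1 then tau' i *: (a' i ⊗ a i)
              else tau' i *: (a' i ⊗ a i)
                   + (1 + tau' i) *: (a i.+1 ⊗ a' i.+1)).

Definition nabla (w : T 1) : T 2 := theta ⊗ w - sigma (w ⊗ theta).

(* d ⊗ id - id ∧ nabla. Neither term alone is well defined over A, but their
   difference is, hence it is determined by its values on composable pairs. *)
Definition d_id_sub_id_nabla : T 2 -> Omega21 :=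
  @lift2 1 1 Omega21 (fun e e' => tens_2_1 (d1 e) e' - wedge_id e (nabla e')).

Definition curvature (w : T 1) : Omega21 := d_id_sub_id_nabla (nabla w).

(* The composite of the lifting iota : Omega^2 -> T 2 with the quotient map
   T 2 -> Omega^2. *)
Definition iota_wedge : T 2 -> T 2 :=
  ext2 (fun=> 0) (fun=> 0)
    (fun i => if i == 1%N then 0
              else 2%:R^-1 *: (a i ⊗ a' i - a' i.-1 ⊗ a i.-1))
    (fun i => if i == n.-1 then 0
              else - (2%:R^-1 *: (a i.+1 ⊗ a' i.+1 - a' i ⊗ a i))).

Definition lifting (w : Omega2) : T 2 := iota_wedge (vrepr w).

(* lifting is well defined: iota_wedge vanishes on the relations. *)
Lemma lifting_wedge (u : T 2) :
  (3 <= n)%N -> lifting (wedge_map u) = iota_wedge u.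
Proof.
move=> n3; pose f : T 2 -> T 2 := iota_wedge.
have fl : linear f by apply: ext2_linear.
pose fL := GRing.isLinear.Build _ _ _ _ f fl.
pose F : {linear T 2 -> T 2} := HB.pack f fL.
have kill r : r \in rels -> F r = 0.
  rewrite /rels !mem_cat !inE => /or4P[H|H|H|].
  - case: (mapP H) => i; rewrite mem_iota => {}H ->; apply: ext2_uu; lia.
  - case: (mapP H) => i; rewrite mem_iota => {}H ->.
    change (f (a' i.+1 ⊗ a' i.+1.-1) = 0); apply: ext2_dd; lia.
  - case: (mapP H) => i; rewrite mem_iota => {}H ->.
    rewrite raddfD [X in X + _]ext2_ud ?[X in _ + X]ext2_du;
      try lia.
    rewrite !ifF ?subrr //; lia.
  - case/orP => /eqP ->.
      by rewrite [LHS]ext2_ud //; lia.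
    by rewrite [LHS]ext2_du ?eqxx //; lia.
have F0 (x : T 2) : x \in <<rels>>%VS -> F x = 0.
  move=> H; rewrite (coord_span H) linear_sum big1 // => i _.
  rewrite linearZ; apply/eqP; rewrite scaler_eq0; apply/orP; right.
  apply/eqP; apply: kill; apply: mem_nth.
  rewrite !size_cat !size_map !size_iota; exact: ltn_ord i.
have := F0 _ (@vreprB _ _ <<rels>>%VS u).
by rewrite raddfB => /eqP; rewrite subr_eq0 => /eqP.
Qed.

(* iota ⊗ id, precomposed with the quotient map T 3 -> Omega^2 ⊗ Omega^1 *)
Definition lifting_id : T 3 -> T 3 :=
  @lift2 2 1 (T 3) (fun w e => @tens 2 1 (lifting (wedge_map w)) e).

Definition id_lifting_id (x : Omega121) : T 4 :=
  @lift2 1 3 (T 4) (fun e y => @tens 1 3 e (lifting_id y)) (vrepr x).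

Definition id_curvature : T 2 -> Omega121 :=
  @lift2 1 1 Omega121 (fun e e' => tens_1_21 e (curvature e')).

Definition pairing_id_id : T 4 -> T 2 :=
  @lift2 2 2 (T 2) (fun x y => lact (pairing x) y).

Definition Ricci : T 2 := pairing_id_id (id_lifting_id (id_curvature metric)).

Definition Ricci_scalar : A := pairing Ricci.

End Geometry.
End LineGraph.

(* Main.v *)
Require Import Defs.
From HB Require Import structures.
From mathcomp Require Import all_boot all_order all_algebra.
From mathcomp Require Import complex zify ring.
From mathcomp Require Import all_classical all_reals all_analysis.

Set Implicit Arguments.
Unset Strict Implicit.
Unset Printing Implicit Defensive.

Import Order.TTheory GRing.Theory Num.Theory.
Local Open Scope ring_scope.

(** Only the 4-step paths [x, y, y+-1, y, x] contribute to the value of [S] at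
    the vertex [x], so [S] is a combination, over the neighbours [y] of [x], of
    two coefficients of the curvature of the arrow [y -> x].  With
    [u_i = (h_i / h_(i+1)) (1 - tau_(i+1)) / (1 + tau_(i+1))] and [u_0 = 0],
    these are multiples of
      [C'_i = u_(i-1) - u_i - tau_i tau_(i+1)]  for the arrow [i+1 -> i],
      [C_i = (1 - tau_i^2) / u_(i-1) - (1 - tau_(i+1)^2) / u_i
             + tau_i tau_(i+1)]  for the arrow [i -> i+1],
    and [S] at the vertex [i] is a nonzero multiple of [C'_i] (if [i <= n-2])
    plus a multiple of [C_(i-1)] (if [i >= 3]).  Since [(i)^2 - (i-1)(i+1) = 1] for q-integers,
    [- tau_i tau_(i+1) = 1 / ((i)(i+1)) = (i)/(i+1) - (i-1)/(i)], so [C'_i = 0]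
    propagates [u_i = (i)/(i+1)] along the graph, and these values of the [u_i]
    make all the [C_i] vanish too. *)

(** * Linear maps and quotients by a span *)

Section LinearMaps.
Variables (K : fieldType) (U V : lmodType K) (f : U -> V) (fl : linear f).

Let F : {linear U -> V} := HB.pack f (GRing.isLinear.Build _ _ _ _ f fl).

Lemma linear_mapD u v : f (u + v) = f u + f v.
Proof. exact: (raddfD F). Qed.

Lemma linear_mapB u v : f (u - v) = f u - f v.
Proof. exact: (raddfB F). Qed.

Lemma linear_map0 : f 0 = 0.
Proof. exact: (raddf0 F). Qed.

Lemma linear_mapZ c u : f (c *: u) = c *: f u.
Proof. exact: (linearZ_LR F). Qed.

Lemma linear_map_sum (I : Type) (r : seq I) (P : pred I) (G : I -> U) :
  f (\sum_(i <- r | P i) G i) = \sum_(i <- r | P i) f (G i).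
Proof. exact: (raddf_sum F). Qed.

End LinearMaps.

Section Span.
Variables (K : fieldType) (U : vectType K) (X : seq U).

Lemma vpi_span x : x \in X -> vpi <<X>>%VS x = 0.
Proof.
move=> xX; rewrite -[RHS](raddf0 (@vpi K U <<X>>%VS)); apply/vpiE.
by rewrite subr0 memv_span.
Qed.

Variables (V : lmodType K) (f : U -> V) (fl : linear f).
Hypothesis fX : forall x, x \in X -> f x = 0.

(** The chosen representative differs from [u] by a combination of elements of [X], all killed by
    [f]. This is what removes the [vrepr] from [tens_2_1], [tens_1_21] and the final contraction. *)
Lemma linear_map_vrepr u : f (vrepr (vpi <<X>>%VS u)) = f u.
Proof.
apply/eqP; rewrite -subr_eq0 -(linear_mapB fl).
have H : vrepr (vpi <<X>>%VS u) - u \in <<in_tuple X>>%VS by apply: vreprB.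
rewrite (coord_span H) (linear_map_sum fl) big1 // => i _.
by rewrite (linear_mapZ fl) fX ?scaler0 //; apply: mem_nth; apply: ltn_ord.
Qed.

End Span.

(** * Coefficients of tensors along paths given by vertex labels *)

Lemma sorted_take_drop (T : Type) (e : rel T) k (l : seq T) : (k < size l)%N ->
  sorted e l = sorted e (take k.+1 l) && sorted e (drop k l).
Proof.
elim: k l => [|k IH] [|x l] //= kl; first by rewrite take0 /=.
by have {}IH := IH l kl; case: l kl IH => // y l kl /= ->; rewrite andbA.
Qed.

(* The coefficient of the path with vertex labels [l], which is 0 when there is
   no such path. *)
HB.lock Definition pcoef (R : realType) (n k : nat) (u : T R n k) (l : seq nat)
  : R[i] := \sum_p u p * (labels p == l)%:R.

Section Coefficients.
Variables (R : realType) (n : nat).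
Local Notation C := R[i].
Implicit Types (l : seq nat) (i j : nat).

(** Being a path is expressed on bare lists of naturals, so that boundary cases become linear
    arithmetic: a list through the label 0 or n+1 is simply not a path. *)
Definition path_ok l : bool :=
  all (fun x => 0 < x <= n)%N l &&
  sorted (fun x y => (y == x.+1) || (x == y.+1)) l.

Lemma scale_regular (c : C) (x : C^o) : c *: x = c * x.
Proof. by []. Qed.

Lemma path_ok_labels k (p : walk n k) : path_ok (labels p).
Proof.
rewrite /path_ok /labels sorted_map (valP p) andbT.
by apply/allP => x /mapP[y _ ->]; rewrite /label /= ltn_ord.
Qed.

Lemma walk_of_labels k l :
  size l = k.+1 -> path_ok l -> exists p : walk n k, labels p = l.
Proof.
move=> sl /andP[/allP al sl'].
have [t tl] : exists t : seq 'I_n, map (@label n) t = l.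
  elim: l al {sl sl'} => [|x l IH] al; first by exists [::].
  have [y yl|t tl] := IH; first by apply: al; rewrite inE yl orbT.
  have := al x (mem_head _ _); case: x {al} => // x /= hx.
  by exists (Ordinal hx :: t); rewrite /= tl.
have st : size t == k.+1 by rewrite -sl -tl size_map.
have ot : sorted (@adj n) (Tuple st) by rewrite -tl sorted_map in sl'.
by exists (exist _ (Tuple st) ot); rewrite /labels /= tl.
Qed.

Lemma pcoef_labels k (u : T R n k) p : pcoef u (labels p) = u p.
Proof.
rewrite pcoef.unlock (bigD1 p) //= eqxx mulr1 big1 ?addr0 // => p' pp'.
by rewrite (inj_eq (@labels_inj n k)) (negbTE pp') mulr0.
Qed.

Lemma pcoef_not_ok k (u : T R n k) l : ~~ path_ok l -> pcoef u l = 0.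
Proof.
move=> H; rewrite pcoef.unlock big1 // => p _; case: eqP => [e|].
  by rewrite -e path_ok_labels in H.
by rewrite mulr0.
Qed.

Lemma pcoef_linear k l : linear (fun u : T R n k => pcoef u l : C^o).
Proof.
move=> c u v; rewrite pcoef.unlock scaler_sumr -big_split /=.
apply: eq_bigr => p _.
by rewrite !ffunE mulrDl !scale_regular mulrA.
Qed.

Lemma pcoefD k (u v : T R n k) l : pcoef (u + v) l = pcoef u l + pcoef v l.
Proof. exact: (linear_mapD (@pcoef_linear k l)). Qed.

Lemma pcoefB k (u v : T R n k) l : pcoef (u - v) l = pcoef u l - pcoef v l.
Proof. exact: (linear_mapB (@pcoef_linear k l)). Qed.

Lemma pcoef0 k l : pcoef (0 : T R n k) l = 0.
Proof. exact: (linear_map0 (@pcoef_linear k l)). Qed.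

Lemma pcoefZ k c (u : T R n k) l : pcoef (c *: u) l = c * pcoef u l.
Proof. exact: (linear_mapZ (@pcoef_linear k l)). Qed.

Lemma pcoef_sum k (I : Type) (r : seq I) (P : pred I) (F : I -> T R n k) l :
  pcoef (\sum_(i <- r | P i) F i) l = \sum_(i <- r | P i) pcoef (F i) l.
Proof. exact: (linear_map_sum (@pcoef_linear k l)). Qed.

Lemma pcoef_path k l l' :
  size l = k.+1 -> pcoef (path_of R n k l) l' = ((l' == l) && path_ok l)%:R.
Proof.
move=> sl; case: (boolP (path_ok l')) => [ok|nok]; last first.
  rewrite pcoef_not_ok //; case: eqP => // e.
  by rewrite -e (negbTE nok).
have [sl'|nsl] := eqVneq (size l') k.+1.
  have [p pl] := walk_of_labels sl' ok.
  rewrite -pl pcoef_labels ffunE; case: eqP => // e.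
  by rewrite -e path_ok_labels.
rewrite [l' == l]negbTE; last by apply: contra nsl => /eqP ->; apply/eqP.
rewrite pcoef.unlock big1 // => p _; rewrite [_ == l']negbTE ?mulr0 //.
by apply: contra nsl => /eqP <-; rewrite /labels size_map size_tuple.
Qed.

Lemma pcoef_path_ok k l l' :
  size l = k.+1 -> path_ok l' -> pcoef (path_of R n k l) l' = (l' == l)%:R.
Proof.
move=> sl ok; rewrite pcoef_path //; by case: eqP => // <-; rewrite ok.
Qed.

Lemma labels_take k m (p : walk n (k + m)) :
  labels (wtake p) = take k.+1 (labels p).
Proof. by rewrite /labels /= map_take. Qed.

Lemma labels_drop k m (p : walk n (k + m)) :
  labels (wdrop p) = drop k (labels p).
Proof. by rewrite /labels /= map_drop. Qed.

(** The two pieces overlap in the entry at position [k], as the factors of a tensor product over [A]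
    share a vertex. *)
Lemma path_ok_split k l : (k < size l)%N ->
  path_ok l = path_ok (take k.+1 l) && path_ok (drop k l).
Proof.
move=> kl; rewrite /path_ok.
have -> : all (fun x => 0 < x <= n)%N l =
  all (fun x => 0 < x <= n)%N (take k.+1 l) &&
  all (fun x => 0 < x <= n)%N (drop k l).
  apply/idP/andP => [/allP H|[]].
    by split; apply/allP => x; [move/mem_take|move/mem_drop]; apply: H.
  rewrite -{3}(cat_take_drop k l) all_cat => H ->; rewrite andbT.
  apply/allP => x xk; apply: (allP H); apply: (@mem_take k).
  by rewrite take_takel.
rewrite (sorted_take_drop _ kl).
by rewrite andbACA.
Qed.

(** If [l] is a path, this is the definition of [tens]; otherwise one of its two pieces is not a
    path either and both sides vanish. *)
Lemma pcoef_tens k m (u : T R n k) (v : T R n m) l : size l = (k + m).+1 ->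
  pcoef (tens u v) l = pcoef u (take k.+1 l) * pcoef v (drop k l).
Proof.
move=> sl; case: (boolP (path_ok l)) => [ok|nok].
  have [p pl] := walk_of_labels sl ok.
  by rewrite -pl -labels_take -labels_drop !pcoef_labels ffunE.
rewrite pcoef_not_ok //; move: nok; rewrite (@path_ok_split k); last first.
  by rewrite sl ltnS leq_addr.
by rewrite negb_and => /orP[H|H]; rewrite (pcoef_not_ok _ H) ?mulr0 ?mul0r.
Qed.

Lemma basisE k (p : walk n k) : Defs.basis R p = path_of R n k (labels p).
Proof.
by apply/ffunP => p'; rewrite !ffunE (inj_eq (@labels_inj n k)).
Qed.

Lemma lift2_linear k m (M : lmodType C) (B : T R n k -> T R n m -> M) :
  linear (lift2 B).
Proof.
move=> c u v; rewrite /lift2 scaler_sumr -big_split; apply: eq_bigr => p _ /=.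
by rewrite !ffunE scalerDl scalerA.
Qed.

Lemma path_not_ok k l : ~~ path_ok l -> path_of R n k l = 0.
Proof.
move=> H; apply/ffunP => p; rewrite !ffunE; case: eqP => // e.
by rewrite -e path_ok_labels in H.
Qed.

Lemma sum_path k (M : lmodType C) (F : walk n k -> M) p :
  \sum_p' path_of R n k (labels p) p' *: F p' = F p.
Proof.
rewrite (bigD1 p) //= ffunE eqxx scale1r big1 ?addr0 // => p' pp'.
by rewrite ffunE (inj_eq (@labels_inj n k)) (negbTE pp') scale0r.
Qed.

Lemma lift2_path k m (M : lmodType C) (B : T R n k -> T R n m -> M) l :
  size l = (k + m).+1 -> path_ok l ->
  lift2 B (path_of R n (k + m) l) =
  B (path_of R n k (take k.+1 l)) (path_of R n m (drop k l)).
Proof.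
move=> sl ok; have [p pl] := walk_of_labels sl ok.
by rewrite -pl -labels_take -labels_drop -!basisE basisE /lift2 sum_path.
Qed.

Lemma tens_linearl k m (v : T R n m) : linear (fun u : T R n k => tens u v).
Proof.
move=> c u u'; apply/ffunP => p; rewrite !ffunE mulrDl.
by rewrite !scale_regular mulrA.
Qed.

Lemma tens_linearr k m (u : T R n k) : linear (fun v : T R n m => tens u v).
Proof.
move=> c v v'; apply/ffunP => p; rewrite !ffunE mulrDr.
by rewrite !scale_regular mulrCA.
Qed.

End Coefficients.

(** * The connection and its curvature *)

Section Connection.
Variables (R : realType) (n : nat).
Local Notation C := R[i].
Local Notation P k l := (path_of R n k l).
Implicit Types (i j : nat).

Lemma pcoef_ext k (u v : T R n k) :
  (forall l, size l = k.+1 -> path_ok n l -> pcoef u l = pcoef v l) -> u = v.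
Proof.
move=> H; apply/ffunP => p; rewrite -!pcoef_labels; apply: H.
  by rewrite /labels size_map size_tuple.
exact: path_ok_labels.
Qed.

(** Each arrow occurs in [theta] exactly once, in the summand indexed by the smaller of its
    labels. *)
Lemma pcoef_theta x y : pcoef (theta R n) [:: x; y] = (path_ok n [:: x; y])%:R.
Proof.
case: (boolP (path_ok n [:: x; y])) => [ok|nok]; last by rewrite pcoef_not_ok.
rewrite /theta pcoef_sum.
transitivity (\sum_(1 <= i < n) ((i == minn x y)%:R : C)).
  apply: eq_big_nat => i Hi; rewrite pcoefD !pcoef_path // -natrD.
  congr _%:R; move: ok; rewrite /path_ok /= !eqseq_cons ?eqxx /=; lia.
have m : (1 <= minn x y < n)%N by move: ok; rewrite /path_ok /=; lia.
rewrite (bigD1_seq (minn x y)) ?iota_uniq ?mem_index_iota //= eqxx.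
by rewrite big1 ?addr0 // => i /negbTE ->.
Qed.

(** The arrows into [y.+1] start at [y] and [y.+2]. At an end of the graph the list through 0 or n+1
    gives the zero tensor, so one formula covers all vertices. *)
Lemma theta_tens y z :
  tens (theta R n) (P 1 [:: y.+1; z]) =
  P 2 [:: y; y.+1; z] + P 2 [:: y.+2; y.+1; z].
Proof.
apply: pcoef_ext => -[|a [|b [|c [|]]]] // _ ok.
rewrite pcoefD (pcoef_tens (k := 1) (m := 1)) //= pcoef_theta.
move: (ok); rewrite (@path_ok_split n 1) //= => /andP[ab bc].
rewrite ab !pcoef_path_ok // mul1r -natrD; congr _%:R.
by move: ok; rewrite /path_ok /= !eqseq_cons ?eqxx /= => /and3P[_]; lia.
Qed.

Lemma tens_theta x y :
  tens (P 1 [:: x; y.+1]) (theta R n) =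
  P 2 [:: x; y.+1; y.+2] + P 2 [:: x; y.+1; y].
Proof.
apply: pcoef_ext => -[|a [|b [|c [|]]]] // _ ok.
rewrite pcoefD (pcoef_tens (k := 1) (m := 1)) //= pcoef_theta.
move: (ok); rewrite (@path_ok_split n 1) //= => /andP[ab bc].
rewrite bc !pcoef_path_ok // mulr1 -natrD; congr _%:R.
by move: ok; rewrite /path_ok /= !eqseq_cons ?eqxx /= => /and3P[_ _]; lia.
Qed.

Variables (s : C) (h : n.-1.-tuple R).

Lemma ext2_not_ok (M : lmodType C) (F1 F2 F3 F4 : nat -> M) l :
  ~~ path_ok n l -> ext2 F1 F2 F3 F4 (P 2 l) = 0.
Proof.
by move=> H; rewrite path_not_ok // (linear_map0 (@ext2_linear R n _ _ _ _ _)).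
Qed.

Lemma sigma_uu j :
  sigma s h (P 2 [:: j.+1; j.+2; j.+3]) =
  sig s h j.+1 *: P 2 [:: j.+1; j.+2; j.+3].
Proof.
case: (boolP (path_ok n [:: j.+1; j.+2; j.+3])) => H; last first.
  rewrite (path_not_ok _ _ H) scaler0 -(path_not_ok R 2 H).
  by rewrite /sigma ext2_not_ok // path_not_ok.
move: H; rewrite /path_ok /= => H; rewrite /sigma ext2_path; try lia.
by rewrite !ltnSn tens_arrow eqxx.
Qed.

Lemma sigma_dd j :
  sigma s h (P 2 [:: j.+2; j.+1; j]) =
  sig' s h j.+1 *: P 2 [:: j.+2; j.+1; j].
Proof.
case: (boolP (path_ok n [:: j.+2; j.+1; j])) => H; last first.
  rewrite (path_not_ok _ _ H) scaler0 -(path_not_ok R 2 H).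
  by rewrite /sigma ext2_not_ok // path_not_ok.
move: H; rewrite /path_ok /= => H; rewrite /sigma ext2_path; try lia.
rewrite ifF ?ltnSn; last lia.
by rewrite tens_arrow /= eqxx.
Qed.

(** For [j = 0] the second path runs through the label 0 and vanishes; this absorbs the exceptional
    clause [i = 1] of [sigma]. *)
Lemma sigma_ud j : (j.+2 <= n)%N ->
  sigma s h (P 2 [:: j.+1; j.+2; j.+1]) =
  tau n s j.+1 *: P 2 [:: j.+1; j.+2; j.+1] +
  (1 + tau n s j.+1) *: P 2 [:: j.+1; j; j.+1].
Proof.
move=> H; rewrite /sigma ext2_path; try lia.
rewrite ltnSn ifF; last lia.
case: j H => [|j] H.
  rewrite eqxx tens_arrow eqxx [X in _ + _ *: X]path_not_ok ?scaler0 ?addr0 //.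
    by rewrite /path_ok /= andbF.
have E : (j.+2 == 1%N) = false by [].
by rewrite E tens_arrow eqxx tens_arrow eqxx.
Qed.

(** Here the vanishing path through n+1 absorbs the exceptional clause [i = n.-1] of [sigma]. *)
Lemma sigma_du j : (j.+2 <= n)%N ->
  sigma s h (P 2 [:: j.+2; j.+1; j.+2]) =
  tau' n s j.+1 *: P 2 [:: j.+2; j.+1; j.+2] +
  (1 + tau' n s j.+1) *: P 2 [:: j.+2; j.+3; j.+2].
Proof.
move=> H; rewrite /sigma ext2_path; try lia.
rewrite ifF; last lia.
rewrite ifF; last lia.
rewrite !tens_arrow !eqxx; case: eqP => // e.
rewrite [X in _ = _ + _ *: X]path_not_ok ?scaler0 ?addr0 //.
rewrite /path_ok /=; lia.
Qed.

Lemma sigmaD u v : sigma s h (u + v) = sigma s h u + sigma s h v.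
Proof. exact: (linear_mapD (@ext2_linear R n _ _ _ _ _)). Qed.

Lemma nabla_a j : (j.+2 <= n)%N ->
  nabla s h (P 1 [:: j.+1; j.+2]) =
  P 2 [:: j; j.+1; j.+2] + P 2 [:: j.+2; j.+1; j.+2]
  - (sig s h j.+1 *: P 2 [:: j.+1; j.+2; j.+3]
     + (tau n s j.+1 *: P 2 [:: j.+1; j.+2; j.+1] +
        (1 + tau n s j.+1) *: P 2 [:: j.+1; j; j.+1])).
Proof.
by move=> H; rewrite /nabla theta_tens tens_theta sigmaD sigma_uu sigma_ud.
Qed.

Lemma nabla_a' j : (j.+2 <= n)%N ->
  nabla s h (P 1 [:: j.+2; j.+1]) =
  P 2 [:: j.+1; j.+2; j.+1] + P 2 [:: j.+3; j.+2; j.+1]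
  - ((tau' n s j.+1 *: P 2 [:: j.+2; j.+1; j.+2] +
      (1 + tau' n s j.+1) *: P 2 [:: j.+2; j.+3; j.+2])
     + sig' s h j.+1 *: P 2 [:: j.+2; j.+1; j]).
Proof.
by move=> H; rewrite /nabla theta_tens tens_theta sigmaD sigma_dd sigma_du.
Qed.

End Connection.

(** * The curvature of single arrows, for a connection of the canonical shape *)

Section Curvature.
Variables (R : realType) (n : nat).
Local Notation C := R[i].
Local Notation P k l := (path_of R n k l).
Implicit Types (i j : nat).

Variables (nab : T R n 1 -> T R n 2) (sg sg' t t' : nat -> C).

Hypothesis nab_a : forall j, (j.+2 <= n)%N ->
  nab (P 1 [:: j.+1; j.+2]) =
  P 2 [:: j; j.+1; j.+2] + P 2 [:: j.+2; j.+1; j.+2]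
  - (sg j.+1 *: P 2 [:: j.+1; j.+2; j.+3]
     + (t j.+1 *: P 2 [:: j.+1; j.+2; j.+1] +
        (1 + t j.+1) *: P 2 [:: j.+1; j; j.+1])).
Hypothesis nab_a' : forall j, (j.+2 <= n)%N ->
  nab (P 1 [:: j.+2; j.+1]) =
  P 2 [:: j.+1; j.+2; j.+1] + P 2 [:: j.+3; j.+2; j.+1]
  - ((t' j.+1 *: P 2 [:: j.+2; j.+1; j.+2] +
      (1 + t' j.+1) *: P 2 [:: j.+2; j.+3; j.+2])
     + sg' j.+1 *: P 2 [:: j.+2; j.+1; j]).

(** A representative in [T 3] of the summand of [d_id_sub_id_nabla], with no quotient taken. *)
Definition d_id_nabla_rep (e e' : T R n 1) : T R n 3 :=
  @tens R n 2 1 (tens (theta R n) e + tens e (theta R n)) e' -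
  @tens R n 1 2 e (nab e').

Definition curvature_rep (w : T R n 1) : T R n 3 :=
  @lift2 R n 1 1 (T R n 3) d_id_nabla_rep (nab w).

Lemma pcoef_d_id_nabla_rep (e e' : T R n 1) x y z w :
  pcoef (d_id_nabla_rep e e') [:: x; y; z; w] =
  ((path_ok n [:: x; y])%:R * pcoef e [:: y; z]
   + pcoef e [:: x; y] * (path_ok n [:: y; z])%:R) * pcoef e' [:: z; w]
  - pcoef e [:: x; y] * pcoef (nab e') [:: y; z; w].
Proof.
rewrite /d_id_nabla_rep pcoefB (pcoef_tens (k := 2) (m := 1)) //=.
rewrite (pcoef_tens (k := 1) (m := 2)) //= pcoefD.
by rewrite !(pcoef_tens (k := 1) (m := 1)) //= !pcoef_theta.
Qed.

Let dR l (w : T R n 2) : C^o :=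
  pcoef (@lift2 R n 1 1 (T R n 3) d_id_nabla_rep w) l.

Let dR_linear l : linear (dR l).
Proof.
by move=> c u v; rewrite /dR (lift2_linear (k := 1) (m := 1)) pcoef_linear.
Qed.

Let dR_path a b c x y z w :
  dR [:: x; y; z; w] (P 2 [:: a; b; c]) =
  if path_ok n [:: a; b; c] then
    ((path_ok n [:: x; y])%:R * pcoef (P 1 [:: a; b]) [:: y; z]
     + pcoef (P 1 [:: a; b]) [:: x; y] * (path_ok n [:: y; z])%:R)
    * pcoef (P 1 [:: b; c]) [:: z; w]
    - pcoef (P 1 [:: a; b]) [:: x; y] *
      pcoef (nab (P 1 [:: b; c])) [:: y; z; w]
  else 0.
Proof.
case: ifP => H; rewrite /dR.
  by rewrite (lift2_path (k := 1) (m := 1)) // pcoef_d_id_nabla_rep.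
by rewrite path_not_ok ?H // (linear_map0 (lift2_linear _)) pcoef0.
Qed.

Let linear_comb (f : T R n 2 -> C^o) (fl : linear f) u1 u2 u3 u4 u5 c3 c4 c5 :
  (f (u1 + u2 - (c3 *: u3 + (c4 *: u4 + c5 *: u5))) =
   f u1 + f u2 - (c3 * f u3 + (c4 * f u4 + c5 * f u5))) *
  (f (u1 + u2 - ((c3 *: u3 + c4 *: u4) + c5 *: u5)) =
   f u1 + f u2 - ((c3 * f u3 + c4 * f u4) + c5 * f u5)).
Proof.
by split; rewrite (linear_mapB fl) !(linear_mapD fl) !(linear_mapZ fl).
Qed.

Let neqS j : ((j == j.+1) = false) * ((j.+1 == j) = false) *
  ((j == j.+2) = false) * ((j.+2 == j) = false) *
  ((j == j.+3) = false) * ((j.+3 == j) = false).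
Proof. by do !split; apply/eqP; lia. Qed.

Let arrow_coef a b c d : path_ok n [:: c; d] ->
  pcoef (P 1 [:: a; b]) [:: c; d] = ((c == a) && (d == b))%:R.
Proof. by move=> ok; rewrite pcoef_path_ok // !eqseq_cons andbT. Qed.

Let path2_coef a b c d e f : path_ok n [:: d; e; f] ->
  pcoef (P 2 [:: a; b; c]) [:: d; e; f] = [&& d == a, e == b & f == c]%:R.
Proof. by move=> ok; rewrite pcoef_path_ok // !eqseq_cons andbT. Qed.

Let ok_up j : (j.+2 <= n)%N ->
  (path_ok n [:: j.+1; j.+2] = true) * (path_ok n [:: j.+2; j.+1] = true).
Proof. by move=> hj; rewrite /path_ok /= (ltnW hj) hj !eqxx !orbT. Qed.

Let ok_3 x y z : path_ok n [:: x; y] = true -> path_ok n [:: y; z] = true ->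
  path_ok n [:: x; y; z] = true.
Proof. by move=> xy yz; rewrite (@path_ok_split _ 1) //= xy yz. Qed.

(** The relation at the vertex j+2 adds the same multiple to both coefficients, so only their
    difference is determined by the class of the curvature. For the canonical connection it is
    [C'_(j+1)]. *)
Lemma curvature_a' j : (j.+3 <= n)%N ->
  pcoef (curvature_rep (P 1 [:: j.+2; j.+1])) [:: j.+2; j.+3; j.+2; j.+1] -
  pcoef (curvature_rep (P 1 [:: j.+2; j.+1])) [:: j.+2; j.+1; j.+2; j.+1] =
  (if j is j'.+1 then sg' j.+1 * (1 + t' j) else 0)
  + t j.+1 * t' j.+1 - (1 + t' j.+1) * sg' j.+2.
Proof.
move=> hj; have hj2 := ltnW hj.
have [ok12 ok21] := ok_up hj2; have [ok23 ok32] := ok_up hj.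
rewrite -![pcoef (curvature_rep _) _]/(dR _ (nab _)) (nab_a' hj2).
rewrite !(linear_comb (dR_linear _)) !dR_path.
rewrite (ok_3 ok12 ok21) (ok_3 ok32 ok21) (ok_3 ok21 ok12) (ok_3 ok23 ok32).
rewrite ok23 ok32 ok21 ok12 !arrow_coef // !eqSS !neqS !eqxx /=.
rewrite !mulr0n !mulr1n !(mul0r, mulr0) !(mul1r, mulr1).
rewrite !(addr0, add0r, subr0, sub0r).
rewrite (nab_a hj2) (nab_a' hj) !(linear_comb (pcoef_linear _)).
rewrite !path2_coef; try exact: ok_3.
rewrite !eqSS !neqS !eqxx /=.
(* For [j = 0] the path of the [sg'] term leaves the graph; otherwise the connection of its second
   arrow contributes the factor [1 + t' j]. *)
case: j hj hj2 ok12 ok21 ok23 ok32 => [|j] hj hj2 ok12 ok21 ok23 ok32.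
  have -> : path_ok n [:: 2; 1; 0]%N = false by rewrite /path_ok /= !andbF.
  by ring.
have [ok01 ok10] := ok_up (ltnW hj2).
rewrite (ok_3 ok21 ok10) (nab_a' (ltnW hj2)) !(linear_comb (pcoef_linear _)).
rewrite !path2_coef; try exact: ok_3.
by rewrite !eqSS !neqS !eqxx /=; ring.
Qed.

(** The corresponding invariant of the upward arrow; for the canonical connection it is
    [C_(j+2)]. *)
Lemma curvature_a j : (j.+3 <= n)%N ->
  pcoef (curvature_rep (P 1 [:: j.+2; j.+3])) [:: j.+2; j.+3; j.+2; j.+3] -
  pcoef (curvature_rep (P 1 [:: j.+2; j.+3])) [:: j.+2; j.+1; j.+2; j.+3] =
  (1 + t j.+2) * sg j.+1
  - (if (j.+4 <= n)%N then sg j.+2 * (1 + t j.+3) else 0)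
  - t j.+2 * t' j.+2.
Proof.
move=> hj; have hj2 := ltnW hj.
have [ok12 ok21] := ok_up hj2; have [ok23 ok32] := ok_up hj.
rewrite -![pcoef (curvature_rep _) _]/(dR _ (nab _)) (nab_a hj).
rewrite !(linear_comb (dR_linear _)) !dR_path.
rewrite (ok_3 ok12 ok23) (ok_3 ok32 ok23) (ok_3 ok23 ok32) (ok_3 ok21 ok12).
rewrite ok23 ok32 ok21 ok12 !arrow_coef // !eqSS !neqS !eqxx /=.
rewrite !mulr0n !mulr1n !(mul0r, mulr0) !(mul1r, mulr1).
rewrite !(addr0, add0r, subr0, sub0r).
rewrite (nab_a hj2) (nab_a' hj) !(linear_comb (pcoef_linear _)).
rewrite !path2_coef; try exact: ok_3.
rewrite !eqSS !neqS !eqxx /=.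
(* The path of the [sg] term ends at the vertex j+4, which is missing when j+3 = n. *)
case: (leqP j.+4 n) => hj4.
  have [ok34 ok43] := ok_up hj4.
  rewrite (ok_3 ok23 ok34) (nab_a hj4) !(linear_comb (pcoef_linear _)).
  rewrite !path2_coef; try exact: ok_3.
  by rewrite !eqSS !neqS !eqxx /=; ring.
have -> : path_ok n [:: j.+2; j.+3; j.+4] = false.
  by apply/negbTE; rewrite /path_ok /=; lia.
by ring.
Qed.

End Curvature.

(** * The contractions *)

Section RicciFunctional.
Variables (R : realType) (n : nat) (h : n.-1.-tuple R).
Hypothesis n3 : (3 <= n)%N.
Local Notation C := R[i].
Local Notation P k l := (path_of R n k l).
Implicit Types (i j x y z : nat).

Lemma tens12_path x y z w t :
  @tens R n 1 3 (P 1 [:: x; y]) (P 3 [:: y; z; w; t]) = P 4 [:: x; y; z; w; t].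
Proof.
apply: pcoef_ext => -[|a [|b [|c [|d [|e [|]]]]]] // _ ok.
rewrite (pcoef_tens (k := 1) (m := 3)) //=.
move: (ok); rewrite (@path_ok_split n 1) //= => /andP[ab bc].
rewrite !pcoef_path_ok // -natrM mulnb; congr (nat_of_bool _)%:R.
rewrite !eqseq_cons; case: (a == x); case: (b == y) => //=.
Qed.

Lemma tens21_path x y z w :
  @tens R n 2 1 (P 2 [:: x; y; z]) (P 1 [:: z; w]) = P 3 [:: x; y; z; w].
Proof.
apply: pcoef_ext => -[|a [|b [|c [|d [|]]]]] // _ ok.
rewrite (pcoef_tens (k := 2) (m := 1)) //=.
move: (ok); rewrite (@path_ok_split n 2) //= => /andP[ab bc].
rewrite !pcoef_path_ok // -natrM mulnb; congr (nat_of_bool _)%:R.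
by rewrite !eqseq_cons; case: (a == x); case: (b == y); case: (c == z).
Qed.

(** The value at [x] of the inverse metric on the loop x, y, x. *)
Definition inv_coef x y : C :=
  if (x < y)%N then (hh h x)^-1 else (hh h y * phi R n y)^-1.

Lemma pairing_path x y z : path_ok n [:: x; y; z] ->
  pairing h (P 2 [:: x; y; z]) =
  if z == x then inv_coef x y *: delta R n x else 0.
Proof.
rewrite /path_ok /= !andbT => /andP[/and3P[hx hy hz] /andP[xy yz]].
rewrite /pairing ext2_path // /inv_coef.
case/orP: xy => /eqP exy; case/orP: yz => /eqP eyz; subst.
- by rewrite !ltnSn ifF //; apply/eqP; lia.
- case: eyz => ->; rewrite ltnSn ifF ?eqxx //; lia.
- by rewrite eqxx (_ : (y.+1 < y)%N = false) //; lia.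
- rewrite ifF; last lia.
  rewrite ltnSn ifF //; apply/eqP; lia.
Qed.

(** The loops at [y] through [y.+1] and [y.-1] have opposite classes in Omega^2, which gives the
    sign; loops at the two ends of the graph have class 0, which gives the bounds on [y]. *)
Lemma iota_path y z t : path_ok n [:: y; z; t] ->
  iota_wedge (P 2 [:: y; z; t]) =
  if (t == y) && (1 < y < n)%N then
    ((-1) ^+ (z < y)%N / 2%:R) *: (P 2 [:: y; y.+1; y] - P 2 [:: y; y.-1; y])
  else 0.
Proof.
rewrite /path_ok /= !andbT => /andP[/and3P[hx hy hz] /andP[xy yz]].
rewrite /iota_wedge ext2_path //.
case/orP: xy => /eqP exy; case/orP: yz => /eqP eyz; subst.
- rewrite !ltnSn ifF //; lia.
- case: eyz => ?; subst t; rewrite ltnSn ifF; last lia.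
  case: eqP => [->//|y1]; rewrite ifT; last lia.
  rewrite (_ : (y.+1 < y)%N = false); last lia.
  by rewrite expr0 mul1r !tens_arrow !eqxx prednK //; lia.
- rewrite eqxx ltnSn (_ : (z.+1 < z)%N = false); last lia.
  case: eqP => [zn|zn]; first by rewrite ifF //; lia.
  rewrite ifT; last lia.
  by rewrite expr1 mulN1r scaleNr !tens_arrow !eqxx.
- rewrite ifF; last lia.
  rewrite ltnSn ifF //; lia.
Qed.

(* The Ricci scalar as a function of a representative in [T 4] of the value of
   [id_curvature] on the metric. *)
Definition scalar_functional (Z : T R n 4) : A R n :=
  pairing h (pairing_id_id h
    (@lift2 R n 1 3 (T R n 4) (fun e u => @tens R n 1 3 e (lifting_id u)) Z)).

Lemma comp_linear (U V W : lmodType C) (f : V -> W) (g : U -> V) :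
  linear f -> linear g -> linear (fun u => f (g u)).
Proof. by move=> fl gl c u v; rewrite gl fl. Qed.

Lemma pairing2_linear :
  linear (fun u : T R n 4 => pairing h (pairing_id_id h u)).
Proof.
apply: comp_linear; first exact: ext2_linear.
exact: (lift2_linear (k := 2) (m := 2)).
Qed.

Lemma scalar_functional_linear : linear scalar_functional.
Proof.
apply: comp_linear pairing2_linear _; exact: (lift2_linear (k := 1) (m := 3)).
Qed.

Lemma lact_delta k x l (c : C) : size l = k.+1 -> head 0%N l = x ->
  lact (c *: delta R n x) (P k l) = c *: P k l.
Proof.
move=> sl hl; apply/ffunP => p; rewrite !ffunE !scale_regular -mulrA.
congr (_ * _); case: (eqVneq (labels p) l) => [pl|_]; last by rewrite !mulr0.
rewrite mulr1; suff -> : label (thead (val p)) = x by rewrite eqxx.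
rewrite -hl -pl /labels; case: (val p) => -[|v q] // i0 /=.
Qed.

(** The first pairing acts on x, y, z and forces [z = x]; the second then acts on x, y, w. *)
Lemma pairing2_path x y z w : path_ok n [:: x; y; z; y; w] ->
  pairing h (pairing_id_id h (P 4 [:: x; y; z; y; w])) =
  if (z == x) && (w == x) then inv_coef x y ^+ 2 *: delta R n x else 0.
Proof.
move=> ok; rewrite /pairing_id_id (lift2_path (k := 2) (m := 2)) //=.
move: ok; rewrite (@path_ok_split n 2) //= => /andP[ok1 ok2].
have pl : linear (pairing h) by apply: ext2_linear.
have l0 v : lact (0 : A R n) (v : T R n 2) = 0.
  by apply/ffunP => p; rewrite !ffunE mul0r.
rewrite pairing_path //; case: eqP => [zx|_] /=; last first.
  by rewrite l0 (linear_map0 pl).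
subst z; rewrite lact_delta // (linear_mapZ pl) pairing_path //.
by case: eqP => _; rewrite ?scaler0 // scalerA expr2.
Qed.

Lemma scalar_functional_path x y z t w : path_ok n [:: x; y; z; t; w] ->
  scalar_functional (P 4 [:: x; y; z; t; w]) =
  if [&& t == y, w == x & (1 < y < n)%N] then
    ((-1) ^+ (z < y)%N * (-1) ^+ (x < y)%N / 2%:R * inv_coef x y ^+ 2)
      *: delta R n x
  else 0.
Proof.
move=> ok; rewrite /scalar_functional (lift2_path (k := 1) (m := 3)) //=.
move: (ok); rewrite (@path_ok_split n 1) //= => /andP[ok1 ok2].
rewrite /lifting_id (lift2_path (k := 2) (m := 1)) //= lifting_wedge //.
move: (ok2); rewrite (@path_ok_split n 2) //= => /andP[ok3 ok4].
rewrite iota_path //.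
pose f u : A R n := pairing h (pairing_id_id h
  (@tens R n 1 3 (P 1 [:: x; y]) (@tens R n 2 1 u (P 1 [:: t; w])))).
have fl : linear f.
  apply: comp_linear pairing2_linear _.
  exact: (comp_linear (@tens_linearr R n 1 3 (P 1 [:: x; y]))
                      (@tens_linearl R n 2 1 (P 1 [:: t; w]))).
have fE z' : path_ok n [:: x; y; z'; y; w] -> t = y ->
    f (P 2 [:: y; z'; y]) =
    if (z' == x) && (w == x) then inv_coef x y ^+ 2 *: delta R n x else 0.
  move=> okz' ty; rewrite /f ty tens21_path tens12_path.
  exact: pairing2_path okz'.
rewrite -[LHS]/(f _); move: f fl fE => f fl fE.
case: (eqVneq t y) => [ty|_] /=; last exact: linear_map0.
case: ifP => y1; last by rewrite andbF (linear_map0 fl).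
rewrite (linear_mapZ fl) (linear_mapB fl) andbT.
move: ok; rewrite ty /path_ok /= => ok.
have ok5 u : (0 < u <= n)%N -> (u == y.+1) || (y == u.+1) ->
    path_ok n [:: x; y; u; y; w] by rewrite /path_ok /=; lia.
rewrite (fE y.+1) ?(fE y.-1) //; try (apply: ok5; lia).
case: (eqVneq w x) => [wx|_]; last by rewrite !andbF subr0 scaler0.
(* Of the two loops in the lift only the one through [x] survives both pairings: [y.-1] if [x] lies
   below [y], which brings a second sign, and [y.+1] otherwise. *)
subst w; move: ok => /and3P[_ /orP[]/eqP exy _].
  rewrite (_ : (y.+1 == x) = false); last by lia.
  rewrite (_ : (y.-1 == x) = true); last by lia.
  rewrite (_ : (x < y)%N = true); last by lia.
  by rewrite sub0r scalerN scalerA -scaleNr; congr (_ *: _); ring.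
rewrite (_ : (y.+1 == x) = true); last by lia.
rewrite (_ : (y.-1 == x) = false); last by lia.
rewrite (_ : (x < y)%N = false); last by lia.
by rewrite subr0 scalerA; congr (_ *: _); ring.
Qed.

Lemma linear_path_ext k (V : lmodType C) (f g : T R n k -> V) :
  linear f -> linear g ->
  (forall l, size l = k.+1 -> path_ok n l -> f (P k l) = g (P k l)) ->
  forall u, f u = g u.
Proof.
move=> fl gl fg u; have -> : u = \sum_p u p *: P k (labels p).
  apply/ffunP => p; rewrite sum_ffunE.
  transitivity (\sum_p' u p' * (p' == p)%:R : C); last first.
    apply: eq_bigr => p' _.
    by rewrite !ffunE (inj_eq (@labels_inj n k)) eq_sym.
  rewrite (bigD1 p) //= eqxx mulr1 big1 ?addr0 // => p' /negbTE ->.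
  by rewrite mulr0.
rewrite (linear_map_sum fl) (linear_map_sum gl); apply: eq_bigr => p _.
rewrite (linear_mapZ fl) (linear_mapZ gl) fg //.
  by rewrite /labels size_map size_tuple.
exact: path_ok_labels.
Qed.

(** The contribution of the neighbour [y] to the scalar at [x]. The bounds also give 0 for the
    labels 0 and n+1, so that [x.-1] and [x.+1] can always be inserted for [y]. *)
Definition scalar_term x y (Z : T R n 4) : C^o :=
  if (1 < y < n)%N then
    (-1) ^+ (x < y)%N / 2%:R * inv_coef x y ^+ 2 *
    (pcoef Z [:: x; y; y.+1; y; x] - pcoef Z [:: x; y; y.-1; y; x])
  else 0.

Lemma scalar_term_linear x y : linear (scalar_term x y).
Proof.
move=> c u v; rewrite /scalar_term; case: ifP => _; last first.
  by rewrite scaler0 addr0.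
by rewrite !(pcoefD, pcoefZ) scale_regular; ring.
Qed.

Lemma scalar_term_path i j x y z t w : path_ok n [:: x; y; z; t; w] ->
  (0 < i <= n)%N -> (j == i.+1) || (i == j.+1) ->
  scalar_term i j (P 4 [:: x; y; z; t; w]) =
  if [&& x == i, y == j, t == j, w == i & (1 < j < n)%N] then
    (-1) ^+ (z < y)%N * ((-1) ^+ (i < j)%N / 2%:R * inv_coef i j ^+ 2)
  else 0.
Proof.
move=> ok hi ij; rewrite /scalar_term.
move: (_ / _ * _) => c; case: ifP => hj; last by rewrite !andbF.
rewrite andbT !pcoef_path_ok //; try (rewrite /path_ok /=; lia).
rewrite !eqseq_cons !(eq_sym i) !(eq_sym j) !eqxx !andbT.
case: (x == i) => //=; last by rewrite subrr mulr0.
case: (eqVneq y j) => //= [yj|_]; last by rewrite subrr mulr0.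
case: (t == j); last by rewrite !andbF subrr mulr0.
case: (w == i); last by rewrite !andbF subrr mulr0.
rewrite !andbT.
have e1 : (j.-1 == j.+1) = false by lia.
have [->|->] : z = j.+1 \/ z = j.-1.
  by move: ok; rewrite yj /path_ok /= => /and4P[_ _ /orP[]/eqP ? _]; lia.
  rewrite eqxx e1 (_ : (j.+1 < y)%N = false); last by lia.
  by rewrite expr0 subr0 mulr1 mul1r.
rewrite eqxx (eq_sym j.+1) e1 (_ : (j.-1 < y)%N = true); last by lia.
by rewrite expr1 sub0r mulrN mulr1 mulN1r.
Qed.

(** Both sides are linear in [Z], so they are compared on single paths. *)
Lemma scalar_functionalE (v : 'I_n) Z : scalar_functional Z v =
  scalar_term (label v) (label v).+1 Z + scalar_term (label v) (label v).-1 Z.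
Proof.
have hi : (0 < label v <= n)%N by rewrite /label /= ltn_ord.
have [i vi] : exists i, label v = i by exists (label v).
rewrite vi in hi *.
move: Z; apply: (@linear_path_ext 4 C^o (fun Z => scalar_functional Z v)
  (fun Z => scalar_term i i.+1 Z + scalar_term i i.-1 Z)).
- by move=> c Z Z'; rewrite scalar_functional_linear !ffunE.
- move=> c Z Z'; rewrite !scalar_term_linear scalerDr.
  by rewrite -!addrA; congr (_ + _); rewrite addrCA.
move=> [|x [|y [|z [|t [|w [|]]]]]] // _ ok; rewrite scalar_functional_path //.
rewrite scalar_term_path ?eqxx //.
have -> : scalar_term i i.-1 (P 4 [:: x; y; z; t; w]) =
  if [&& x == i, y == i.-1, t == i.-1, w == i & (1 < i.-1 < n)%N] then
    (-1) ^+ (z < y)%N * ((-1) ^+ (i < i.-1)%N / 2%:R * inv_coef i i.-1 ^+ 2)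
  else 0.
  case: (ltnP 1 i) => i1; first by rewrite scalar_term_path //; lia.
  rewrite /scalar_term (_ : (1 < i.-1)%N = false); last by lia.
  by rewrite /= !andbF.
rewrite (fun_if (fun u : A R n => u v)) !ffunE vi.
case: (eqVneq x i) => [xi|_] /=; last by rewrite scaler0 if_same addr0.
subst x; rewrite scale_regular mulr1.
have [yi|yi] : y = i.+1 \/ y = i.-1 by move: ok; rewrite /path_ok /=; lia.
  rewrite yi eqxx (_ : (i.+1 == i.-1) = false) /= ?addr0; last by lia.
  by case: (t == i.+1) => //=; case: (w == i) => //=; case: ifP => // _; ring.
have i0 : (0 < y)%N by move: ok; rewrite /path_ok /=; lia.
rewrite yi eqxx (_ : (i.-1 == i.+1) = false) /= ?add0r; last by lia.
by case: (t == i.-1) => //=; case: (w == i) => //=; case: ifP => // _; ring.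
Qed.

End RicciFunctional.

(** * The recursion *)

Section Recursion.
Variables (F : fieldType) (n : nat) (b H : nat -> F) (s : F).
Hypotheses (b0 : b 0 = 0) (bn : b n.+1 = 0).
Hypothesis b_neq0 : forall k, (1 <= k <= n)%N -> b k != 0.
Hypothesis b_det : forall k, b k.+1 ^+ 2 - b k * b k.+2 = 1.
Hypothesis s2 : s ^+ 2 = 1.
Hypothesis H_neq0 : forall k, (1 <= k < n)%N -> H k != 0.

(** This is [tau_k] over an arbitrary field, with [b k] for the q-integer; it is used over both the
    real and the complex numbers. *)
Definition alt_ratio k : F := s * (-1) ^+ k.-1 / b k.
Local Notation t := alt_ratio.

Let tt k : (k.+2 <= n)%N -> t k.+1 * t k.+2 = - (b k.+1 * b k.+2)^-1.
Proof.
move=> hk; rewrite /alt_ratio /= mulf_div mulrACA -expr2 s2 mul1r.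
by rewrite exprS mulN1r mulrN -expr2 sqrr_sign mulN1r.
Qed.

(** By [b_det], [1 - t_k^2 = b_(k-1) b_(k+1) / b_k^2], and the bounds on [k] keep all three indices
    between 1 and n. *)
Lemma alt_ratio_neq1 k : (2 <= k < n)%N -> (1 + t k != 0) && (1 - t k != 0).
Proof.
case: k => [|[|k]] // hk.
have t2 : (1 + t k.+2) * (1 - t k.+2) = b k.+1 * b k.+3 / b k.+2 ^+ 2.
  rewrite [(1 + _) * (1 - _)]mulrC -subr_sqr expr1n.
  rewrite /alt_ratio !exprMn s2 sqrr_sign exprVn !mul1r.
  have E := b_det k.+1; have b2 : b k.+2 != 0 by apply: b_neq0; lia.
  have -> : b k.+1 * b k.+3 = b k.+2 ^+ 2 - 1 by rewrite -E; ring.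
  by field.
rewrite -negb_or -mulf_eq0 t2 !mulf_eq0 invr_eq0 expf_eq0 /= !negb_or.
by rewrite !b_neq0 //; lia.
Qed.

Let U k := H k / H k.+1 * ((1 - t k.+1) / (1 + t k.+1)).

(* [C'_(j+1)]; here [b] stands for the q-integers and [H] for the [h_i]. *)
Definition up_term j : F :=
  (if j is j'.+1 then H j / H j.+1 * (1 + t j.+1)^-1 * (1 + - t j.+1) else 0)
  + t j.+1 * - t j.+2 - (1 + - t j.+2) * (H j.+1 / H j.+2 * (1 + t j.+2)^-1).

(* [C_(j+2)] *)
Definition down_term j : F :=
  (1 + t j.+2) * (H j.+2 / H j.+1 * (1 + t j.+2))
  - (if (j.+4 <= n)%N then H j.+3 / H j.+2 * (1 + t j.+3) * (1 + t j.+3) else 0)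
  - t j.+2 * - t j.+3.

Let good k := U k = b k / b k.+1.

(** Once [U j = b j / b j.+1], the first two terms add up by [b_det] to [b j.+1 / b j.+2], and the
    third is [- U j.+1]. *)
Let up_term_eq0 j : (j.+3 <= n)%N -> ((0 < j)%N -> good j) ->
  up_term j = 0 <-> good j.+1.
Proof.
move=> hj gj.
have b1' : b j.+1 != 0 by apply: b_neq0; lia.
have b2' : b j.+2 != 0 by apply: b_neq0; lia.
have -> : up_term j = b j.+1 / b j.+2 - U j.+1.
  have -> : up_term j = b j / b j.+1 - t j.+1 * t j.+2 - U j.+1.
    (* For [j = 0] the absent term agrees with [b 0 / b 1 = 0], the convention [u_0 = 0]. *)
    rewrite /up_term; have -> : (if j is j'.+1 then
      H j / H j.+1 * (1 + t j.+1)^-1 * (1 + - t j.+1) else 0) = b j / b j.+1.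
      case: j {hj b1' b2'} gj => [|j] gj; first by rewrite b0 mul0r.
      by rewrite -gj // /U; ring.
    by rewrite /U; ring.
  rewrite tt; last lia.
  rewrite opprK; congr (_ - _); rewrite -[X in _ + X]mul1r -(b_det j).
  by field; rewrite b1' b2'.
by rewrite /good; split => [/eqP|->]; rewrite ?subrr // subr_eq0 => /eqP.
Qed.

(** The left side is [(1 - t j.+2 ^+ 2) / U j.+1], and its numerator is
    [b j.+1 * b j.+3 / b j.+2 ^+ 2]. *)
Let V_good j : (j.+3 <= n)%N -> good j.+1 ->
  H j.+2 / H j.+1 * (1 + t j.+2) * (1 + t j.+2) = b j.+3 / b j.+2.
Proof.
move=> hj; rewrite /good /U.
have b1' : b j.+1 != 0 by apply: b_neq0; lia.
have b2' : b j.+2 != 0 by apply: b_neq0; lia.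
have H1 : H j.+1 != 0 by apply: H_neq0; lia.
have H2 : H j.+2 != 0 by apply: H_neq0; lia.
have /andP[tp tm] := alt_ratio_neq1 (k := j.+2) hj.
have t2 : (1 + t j.+2) * (1 - t j.+2) * b j.+2 ^+ 2 = b j.+1 * b j.+3.
  rewrite [(1 + _) * (1 - _)]mulrC -subr_sqr expr1n.
  rewrite {1}/alt_ratio !exprMn s2 sqrr_sign exprVn !mul1r.
  by rewrite mulrBl mulVf ?expf_neq0 // mul1r -(b_det j.+1); ring.
move=> E; have {}E : H j.+1 * (1 - t j.+2) * b j.+2 =
    H j.+2 * (1 + t j.+2) * b j.+1.
  have := congr1 (fun x => x * (H j.+2 * (1 + t j.+2) * b j.+2)) E.
  have -> : H j.+1 / H j.+2 * ((1 - t j.+2) / (1 + t j.+2)) *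
    (H j.+2 * (1 + t j.+2) * b j.+2) = H j.+1 * (1 - t j.+2) * b j.+2.
    by field; rewrite H2 tp.
  by move=> ->; field.
apply: (mulIf (mulf_neq0 (mulf_neq0 H1 b1') b2')).
have -> : H j.+2 / H j.+1 * (1 + t j.+2) * (1 + t j.+2) *
  (H j.+1 * b j.+1 * b j.+2) =
  (H j.+2 * (1 + t j.+2) * b j.+1) * ((1 + t j.+2) * b j.+2) by field.
rewrite -E.
have -> : b j.+3 / b j.+2 * (H j.+1 * b j.+1 * b j.+2) =
  H j.+1 * (b j.+1 * b j.+3) by field.
by rewrite -t2; ring.
Qed.

(** The term becomes [b j.+3 / b j.+2 - b j.+4 / b j.+3 - (b j.+2 * b j.+3)^-1], which is 0 by
    [b_det]. *)
Let down_term_eq0 j : (j.+3 <= n)%N -> good j.+1 ->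
  ((j.+4 <= n)%N -> good j.+2) -> down_term j = 0.
Proof.
move=> hj g1 g2.
have b2' : b j.+2 != 0 by apply: b_neq0; lia.
have b3' : b j.+3 != 0 by apply: b_neq0; lia.
rewrite /down_term mulrC (V_good hj g1).
(* At the end [j.+3 = n] the missing term agrees with [b n.+1 / b n = 0]. *)
have -> : (if (j.+4 <= n)%N then
    H j.+3 / H j.+2 * (1 + t j.+3) * (1 + t j.+3) else 0) = b j.+4 / b j.+3.
  case: ifP => hj4; first by rewrite (V_good hj4 (g2 hj4)).
  by rewrite (_ : j.+4 = n.+1) ?bn ?mul0r //; lia.
rewrite mulrN opprK tt // -[(b j.+2 * b j.+3)^-1]mul1r -(b_det j.+2).
by field; rewrite b2' b3'.
Qed.

(** The equations with [j.+3 <= n] determine the ratios one after the other: the ratios already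
    known kill the down term, which leaves the up term. The remaining equations contain at most a
    down term and then hold automatically. *)
Lemma scalar_eq0_iff : 2%:R != 0 :> F ->
  (forall j, (j.+1 <= n)%N ->
     (if (j.+3 <= n)%N then
        - 2%:R^-1 * (H j.+1)^-1 ^+ 2 * (H j.+1 * (b j.+2 / b j.+1)) * up_term j
      else 0) +
     (if j is j'.+2 then
        2%:R^-1 * (H j'.+2 * (b j'.+3 / b j'.+2))^-1 ^+ 2 * H j'.+2 *
        down_term j'
      else 0) = 0) <->
  (forall j, (j.+3 <= n)%N ->
     H j.+1 / H j.+2 * ((1 - t j.+2) / (1 + t j.+2)) = b j.+1 / b j.+2).
Proof.
move=> two_neq0; split=> [S0 j|G j hj].
  elim/ltn_ind: j => j IH hj; apply/(up_term_eq0 hj).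
    by case: j IH hj => // j IH hj _; apply: IH; lia.
  have := S0 j; rewrite hj.
  have -> : (if j is j'.+2 then
      2%:R^-1 * (H j'.+2 * (b j'.+3 / b j'.+2))^-1 ^+ 2 * H j'.+2 *
      down_term j' else 0) = 0.
    case: j IH hj => [|[|j]] // IH hj.
    by rewrite down_term_eq0 ?mulr0 // => *; try apply: IH; lia.
  rewrite addr0 => /(_ (ltnW (ltnW hj)))/eqP; rewrite mulf_eq0 => /orP[|/eqP//].
  rewrite !mulf_eq0 oppr_eq0 !invr_eq0.
  rewrite (negbTE two_neq0) !(negbTE (b_neq0 _)) ?(negbTE (H_neq0 _)) //;
    lia.
have {}G k : (0 < k)%N -> (k.+2 <= n)%N -> good k.
  by case: k => // k _; apply: G.
rewrite [X in X + _](_ : _ = 0) ?add0r.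
  case: j hj => [|[|j]] // hj; rewrite down_term_eq0 ?mulr0 //; first exact: G.
  by move=> ?; apply: G.
case: ifP => // hj3; rewrite (_ : up_term j = 0) ?mulr0 //.
by apply/(up_term_eq0 hj3) => [j0|]; apply: G; lia.
Qed.

End Recursion.

(** * The Ricci scalar *)

Section Ricci.
Variables (R : realType) (n : nat) (s : R[i]) (h : n.-1.-tuple R).
Hypothesis n3 : (3 <= n)%N.
Local Notation C := R[i].
Local Notation P k l := (path_of R n k l).
Implicit Types (i j x y z : nat).

(** Only the relation at [y] involves these two loops, with coefficient 1 on both; so the difference
    of the two coefficients is well defined on Omega^2. *)
Lemma rels_pcoef (r : T R n 2) y : r \in rels R n -> (1 < y < n)%N ->
  pcoef r [:: y; y.+1; y] = pcoef r [:: y; y.-1; y].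
Proof.
move=> rr hy.
have [ok1 ok2] : path_ok n [:: y; y.+1; y] /\ path_ok n [:: y; y.-1; y].
  by rewrite /path_ok /=; lia.
move: rr; rewrite /rels !mem_cat !inE => /or4P[H|H|H|].
- case: (mapP H) => i; rewrite mem_iota => hi ->.
  rewrite tens_arrow eqxx !pcoef_path_ok //.
  by rewrite !eqseq_cons; congr (nat_of_bool _)%:R; lia.
- case: (mapP H) => i; rewrite mem_iota => hi ->.
  rewrite tens_arrow eqxx !pcoef_path_ok //.
  by rewrite !eqseq_cons; congr (nat_of_bool _)%:R; lia.
- case: (mapP H) => i; rewrite mem_iota => hi ->.
  rewrite !tens_arrow !eqxx !pcoefD !pcoef_path_ok //.
  by rewrite !eqseq_cons -!natrD; congr _%:R; lia.
case/orP => /eqP ->; rewrite tens_arrow eqxx !pcoef_path_ok //;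
  by rewrite !eqseq_cons; congr (nat_of_bool _)%:R; lia.
Qed.

Lemma scalar_term_rels x y Z : Z \in rels_lr R n -> scalar_term h x y Z = 0.
Proof.
case/allpairsP => -[e r] /= [_ /allpairsP[[r' e'] /= [r'r _ ->]] ->].
rewrite /scalar_term; case: ifP => // hy.
rewrite !(pcoef_tens (k := 1) (m := 3)) //= !(pcoef_tens (k := 2) (m := 1)) //=.
by rewrite (rels_pcoef r'r hy) subrr mulr0.
Qed.

Lemma basis_arrow (p : walk n 1) : Defs.basis R p \in arrows R n.
Proof.
rewrite basisE; have := path_ok_labels p.
have : size (labels p) = 2 by rewrite /labels size_map size_tuple.
case: (labels p) => [|x [|y []]] // _.
rewrite /path_ok /= !andbT => /andP[/andP[hx hy] /orP[]/eqP e]; subst.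
  rewrite /arrows mem_cat; apply/orP; left; apply/mapP; exists x => //.
  by rewrite mem_iota; lia.
rewrite /arrows mem_cat; apply/orP; right; apply/mapP; exists y => //.
by rewrite mem_iota; lia.
Qed.

(** A relation times an arrow lies in [rels_r], so the representative chosen in [tens_2_1] does not
    affect the class. *)
Lemma tens_2_1_wedge (u : T R n 2) v : v \in arrows R n ->
  tens_2_1 (wedge_map u) v = vpi <<rels_r R n>>%VS (@tens R n 2 1 u v).
Proof.
move=> vv; apply: (@linear_map_vrepr _ _ (rels R n) (Omega21 R n)
  (fun u => vpi <<rels_r R n>>%VS (@tens R n 2 1 u v))).
  by move=> c u1 u2; rewrite (@tens_linearl R n 2 1) vpi_is_linear.
move=> r rr; apply: vpi_span; exact: allpairs_f.
Qed.

Lemma tens_1_21_vpi v (u : T R n 3) : v \in arrows R n ->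
  tens_1_21 v (vpi <<rels_r R n>>%VS u) =
  vpi <<rels_lr R n>>%VS (@tens R n 1 3 v u).
Proof.
move=> vv; apply: (@linear_map_vrepr _ _ (rels_r R n) (Omega121 R n)
  (fun u => vpi <<rels_lr R n>>%VS (@tens R n 1 3 v u))).
  by move=> c u1 u2; rewrite (@tens_linearr R n 1 3) vpi_is_linear.
move=> r rr; apply: vpi_span; exact: allpairs_f.
Qed.

Lemma curvatureE w :
  curvature s h w = vpi <<rels_r R n>>%VS (curvature_rep (nabla s h) w).
Proof.
rewrite /curvature_rep /lift2 (linear_map_sum (@vpi_is_linear _ _ _)).
apply: eq_bigr => p _; rewrite (linear_mapZ (@vpi_is_linear _ _ _)).
congr (_ *: _); rewrite /d_id_nabla_rep (linear_mapB (@vpi_is_linear _ _ _)).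
congr (_ - _); rewrite -tens_2_1_wedge ?basis_arrow //; congr tens_2_1.
by rewrite /d1 /wedge /wedge_map (linear_mapD (@vpi_is_linear _ _ _)).
Qed.

(** A representative in [T 4] of [id_curvature] on the metric, built from [curvature_rep]. *)
Definition ricci_rep : T R n 4 :=
  @lift2 R n 1 1 (T R n 4)
    (fun e e' => @tens R n 1 3 e (curvature_rep (nabla s h) e')) (metric h).

Lemma id_curvatureE :
  id_curvature s h (metric h) = vpi <<rels_lr R n>>%VS ricci_rep.
Proof.
rewrite /ricci_rep /lift2 (linear_map_sum (@vpi_is_linear _ _ _)).
apply: eq_bigr => p _; rewrite (linear_mapZ (@vpi_is_linear _ _ _)).
by rewrite curvatureE tens_1_21_vpi ?basis_arrow.
Qed.

Lemma Ricci_scalarE (v : 'I_n) : Ricci_scalar s h v =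
  scalar_term h (label v) (label v).+1 ricci_rep +
  scalar_term h (label v) (label v).-1 ricci_rep.
Proof.
rewrite -[LHS]/(scalar_functional h (vrepr (id_curvature s h (metric h))) v).
rewrite scalar_functionalE // id_curvatureE.
congr (_ + _); apply: (@linear_map_vrepr _ _ (rels_lr R n) C^o);
  by [apply: scalar_term_linear | move=> Z; apply: scalar_term_rels].
Qed.

Lemma sum_nat_pick i (F : nat -> C) : (1 <= i < n)%N ->
  (forall k, k != i -> F k = 0) -> \sum_(1 <= k < n) F k = F i.
Proof.
move=> hi F0; rewrite (bigD1_seq i) ?iota_uniq ?mem_index_iota //=.
by rewrite big1 ?addr0 // => k ki; apply: F0.
Qed.

(** A term of the metric contributes only if its first arrow goes from [x] to [y]; the curvature is
    then that of the reverse arrow. *)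
Lemma pcoef_ricci_rep x y z w t : path_ok n [:: x; y] ->
  let Y e := pcoef (curvature_rep (nabla s h) (P 1 e)) [:: y; z; w; t] in
  pcoef ricci_rep [:: x; y; z; w; t] =
  \sum_(1 <= k < n) hh h k *
    (phi R n k * (if (x == k) && (y == k.+1) then Y [:: k.+1; k] else 0) +
     (if (x == k.+1) && (y == k) then Y [:: k; k.+1] else 0)).
Proof.
move=> okxy Y.
pose f u : C^o := pcoef (@lift2 R n 1 1 (T R n 4)
  (fun e e' => @tens R n 1 3 e (curvature_rep (nabla s h) e')) u)
  [:: x; y; z; w; t].
have fl : linear f.
  exact: comp_linear (@pcoef_linear R n 4 _) (lift2_linear (k := 1) (m := 1) _).
have fP a b : path_ok n [:: a; b; a] ->
  f (P 2 [:: a; b; a]) = if (x == a) && (y == b) then Y [:: b; a] else 0.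
  move=> ok; rewrite /f (lift2_path (k := 1) (m := 1)) //=.
  rewrite (pcoef_tens (k := 1) (m := 3)) //= pcoef_path_ok // !eqseq_cons andbT.
  by rewrite -/(Y _); case: ifP => _; rewrite ?mul1r ?mul0r.
rewrite -[LHS]/(f (metric h)); move: f fl fP => f fl fP.
rewrite /metric (linear_map_sum fl) big_nat_cond [RHS]big_nat_cond.
apply: eq_bigr => k; rewrite andbT => hk.
rewrite (linear_mapZ fl) (linear_mapD fl) (linear_mapZ fl).
by rewrite !tens_arrow !eqxx !fP //; rewrite /path_ok /=; lia.
Qed.

Lemma metric_sum i (a b : nat -> C) (Y : seq nat -> C) : (1 <= i < n)%N ->
  (\sum_(1 <= k < n) a k *
    (b k * (if (i == k) && (i.+1 == k.+1) then Y [:: k.+1; k] else 0) +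
     (if (i == k.+1) && (i.+1 == k) then Y [:: k; k.+1] else 0)) =
   a i * (b i * Y [:: i.+1; i])) *
  (\sum_(1 <= k < n) a k *
    (b k * (if (i.+1 == k) && (i == k.+1) then Y [:: k.+1; k] else 0) +
     (if (i.+1 == k.+1) && (i == k) then Y [:: k; k.+1] else 0)) =
   a i * Y [:: i; i.+1]).
Proof.
have E k : (i == k.+1) && (i.+1 == k) = false by lia.
move=> hi; split; rewrite (sum_nat_pick hi).
- by rewrite E !eqxx addr0.
- by move=> k ki; rewrite E (eq_sym i) (negbTE ki) mulr0 addr0 mulr0.
- by rewrite andbC E !eqxx mulr0 add0r.
- move=> k ki; rewrite andbC E (eq_sym i) (negbTE ki) andbF.
  by rewrite mulr0 addr0 mulr0.
Qed.

Lemma pcoef_ricci_rep_edge i z : (1 <= i < n)%N ->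
  (pcoef ricci_rep [:: i; i.+1; z; i.+1; i] = hh h i * (phi R n i *
     pcoef (curvature_rep (nabla s h) (P 1 [:: i.+1; i]))
       [:: i.+1; z; i.+1; i])) *
  (pcoef ricci_rep [:: i.+1; i; z; i; i.+1] = hh h i *
     pcoef (curvature_rep (nabla s h) (P 1 [:: i; i.+1]))
       [:: i; z; i; i.+1]).
Proof.
move=> hi; split; (rewrite pcoef_ricci_rep; last by rewrite /path_ok /=; lia).
  exact: (metric_sum (hh h) (phi R n)
    (fun e => pcoef (curvature_rep (nabla s h) (P 1 e)) _) hi).1.
exact: (metric_sum (hh h) (phi R n)
  (fun e => pcoef (curvature_rep (nabla s h) (P 1 e)) _) hi).2.
Qed.

Lemma scalar_term_up j : (j.+3 <= n)%N ->
  scalar_term h j.+1 j.+2 ricci_rep =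
  - 2%:R^-1 * (hh h j.+1)^-1 ^+ 2 * (hh h j.+1 * phi R n j.+1)
  * up_term (qint R n) (hh h) s j.
Proof.
move=> hj; rewrite /scalar_term hj ltnSn /inv_coef ltnSn expr1.
(* For the canonical coefficients the right side of [curvature_a'] is convertible to [up_term],
   [tau] being [alt_ratio] over the q-integers. *)
have E : _ - _ = up_term (qint R n) (hh h) s j :=
  curvature_a' (@nabla_a R n s h) (@nabla_a' R n s h) hj.
rewrite -{}E.
rewrite !(pcoef_ricci_rep_edge (i := j.+1)) ?(ltnW hj) //.
move: (pcoef _ _) (pcoef _ _) => Y1 Y2.
by rewrite mulN1r !mulNr; congr (- _); ring.
Qed.

Lemma scalar_term_down j : (j.+3 <= n)%N ->
  scalar_term h j.+3 j.+2 ricci_rep =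
  2%:R^-1 * (hh h j.+2 * phi R n j.+2)^-1 ^+ 2 * hh h j.+2 *
  down_term n (qint R n) (hh h) s j.
Proof.
move=> hj; rewrite /scalar_term hj /inv_coef.
rewrite (_ : (j.+3 < j.+2)%N = false) ?expr0; last by lia.
have E : _ - _ = down_term n (qint R n) (hh h) s j :=
  curvature_a (@nabla_a R n s h) (@nabla_a' R n s h) hj.
rewrite -{}E.
rewrite !(pcoef_ricci_rep_edge (i := j.+2)) ?hj //.
by move: (pcoef _ _) (pcoef _ _) => Y1 Y2; ring.
Qed.

(** The upper neighbour j+2 is interior when [j.+3 <= n], the lower neighbour [j] when [2 <= j]; a
    neighbour at an end of the graph contributes 0. *)
Lemma Ricci_scalar_label (v : 'I_n) j : label v = j.+1 -> Ricci_scalar s h v =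
  (if (j.+3 <= n)%N then
     - 2%:R^-1 * (hh h j.+1)^-1 ^+ 2 * (hh h j.+1 * phi R n j.+1) *
     up_term (qint R n) (hh h) s j else 0) +
  (if j is j'.+2 then
     2%:R^-1 * (hh h j'.+2 * phi R n j'.+2)^-1 ^+ 2 * hh h j'.+2 *
     down_term n (qint R n) (hh h) s j' else 0).
Proof.
move=> vj; have hj : (j.+1 <= n)%N by rewrite -vj /label ltn_ord.
rewrite Ricci_scalarE vj; congr (_ + _).
  case: ifP => hj3; first by rewrite scalar_term_up.
  by rewrite /scalar_term hj3 andbF.
case: j hj {vj} => [|[|j]] hj; rewrite ?scalar_term_down //.
Qed.

End Ricci.

(** * Real q-integers and the flat metric *)

Section QuantumIntegers.
Variables (R : realType) (n : nat).
Hypothesis n1 : (1 <= n)%N.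
Local Open Scope complex_scope.

Let th : R := pi / n.+1%:R.

(** Since [q^k - q^(-k) = 2 i sin (k th)], this is the q-integer as a real number. *)
Definition real_qint k : R := sin (k%:R * th) / sin th.

Let sin_th_gt0 k : (1 <= k <= n)%N -> 0 < sin (k%:R * th).
Proof.
move=> hk; have n0 : 0 < n.+1%:R :> R by rewrite ltr0n.
apply: sin_gt0_pi; apply/andP; split.
  by rewrite mulr_gt0 ?divr_gt0 ?pi_gt0 ?ltr0n //; lia.
by rewrite /th mulrA ltr_pdivrMr // mulrC ltr_pM2l ?pi_gt0 // ltr_nat; lia.
Qed.

Let sin_th : sin th != 0.
Proof. by rewrite -[th]mul1r gt_eqF // (sin_th_gt0 (k := 1)). Qed.

Lemma real_qint_neq0 k : (1 <= k <= n)%N -> real_qint k != 0.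
Proof.
by move=> hk; rewrite mulf_neq0 ?invr_eq0 ?sin_th // gt_eqF // sin_th_gt0.
Qed.

Lemma real_qint0 : real_qint 0 = 0.
Proof. by rewrite /real_qint mul0r sin0 mul0r. Qed.

Lemma real_qintSn : real_qint n.+1 = 0.
Proof.
by rewrite /real_qint /th mulrCA divff ?mulr1 ?sinpi ?mul0r // pnatr_eq0.
Qed.

(** With [x = (k+1) th], this is [sin^2 x - sin (x - th) sin (x + th) = sin^2 th] divided by
    [sin^2 th]. *)
Lemma real_qint_det k :
  real_qint k.+1 ^+ 2 - real_qint k * real_qint k.+2 = 1.
Proof.
set x := k.+1%:R * th.
have -> : real_qint k = (sin x * cos th - cos x * sin th) / sin th.
  by rewrite /real_qint -sinB /x -natr1; congr (sin _ / _); ring.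
have -> : real_qint k.+2 = (sin x * cos th + cos x * sin th) / sin th.
  by rewrite /real_qint -sinD /x -[k.+2%:R]natr1; congr (sin _ / _); ring.
have cx := cos2Dsin2 x; have ct := cos2Dsin2 th.
rewrite /real_qint -/x; move: (sin x) (cos x) (cos th) cx ct => sx cx ct E1 E2.
apply: (mulIf (expf_neq0 2 sin_th)); rewrite mul1r.
transitivity (sx ^+ 2 * (1 - ct ^+ 2) + cx ^+ 2 * sin th ^+ 2).
  by field.
have -> : 1 - ct ^+ 2 = sin th ^+ 2 by rewrite -E2; ring.
by rewrite -mulrDl [sx ^+ 2 + _]addrC E1 mul1r.
Qed.

Let q_exp k : q R n ^+ k = cos (k%:R * th) +i* sin (k%:R * th).
Proof.
elim: k => [|k IH]; first by rewrite expr0 mul0r cos0 sin0.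
rewrite exprSr IH -natr1 mulrDl mul1r cosD sinD.
by apply/eqP; rewrite eq_complex /= addrC [X in _ && (X == _)]addrC !eqxx.
Qed.

Let q_expV k : q R n ^- k = cos (k%:R * th) -i* sin (k%:R * th).
Proof.
apply: mulr1_eq; rewrite q_exp; apply/eqP; rewrite eq_complex /=.
rewrite mulrN opprK -!expr2 cos2Dsin2 eqxx /=.
by apply/eqP; ring.
Qed.

Lemma qint_real k : qint R n k = (real_qint k)%:C.
Proof.
have E m : q R n ^+ m - q R n ^- m = (2%:R * 'i) * (sin (m%:R * th))%:C.
  rewrite q_expV q_exp; apply/eqP; rewrite eq_complex /=.
  by apply/andP; split; apply/eqP; ring.
have := E 1%N; rewrite mul1r expr1 /qint E => ->.
rewrite -mulf_div divff ?mul1r; last first.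
  by rewrite mulf_neq0 ?pnatr_eq0 // neq0Ci.
by rewrite /real_qint rmorphM fmorphV.
Qed.

End QuantumIntegers.

(** * Solving the recursion in real metric parameters *)

Section Solution.
Variables (R : realType) (n : nat) (s : R).
Hypotheses (n3 : (3 <= n)%N) (s2 : s ^+ 2 = 1).
Local Open Scope complex_scope.
Local Notation b := (real_qint R n).
Local Notation t := (alt_ratio b s).
Implicit Type h : n.-1.-tuple R.

Let n1 : (1 <= n)%N. Proof. exact: leq_trans n3. Qed.

(* The value of [h_(j+1) / h_(j+2)] forced by [S = 0]. *)
Definition flat_ratio j : R :=
  b j.+1 / b j.+2 * ((1 + t j.+2) / (1 - t j.+2)).

Lemma flat_ratio_neq0 j : (j.+3 <= n)%N -> flat_ratio j != 0.
Proof.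
move=> hj.
have /andP[tp tm] := alt_ratio_neq1 (real_qint_neq0 R n1)
  (real_qint_det R n1) s2 (k := j.+2) hj.
have b1 : b j.+1 != 0 by apply: real_qint_neq0 => //; lia.
have b2 : b j.+2 != 0 by apply: real_qint_neq0 => //; lia.
rewrite /flat_ratio; apply: mulf_neq0.
  by rewrite mulf_eq0 negb_or invr_eq0 b1.
by rewrite mulf_eq0 negb_or invr_eq0 tp.
Qed.

(** [scalar_eq0_iff] is applied over the complex numbers. All quantities in the resulting recursion
    are images of reals, so it descends to the reals by injectivity. *)
Lemma Ricci_scalar_eq0_iff h : (forall i, tnth h i != 0) ->
  Ricci_scalar s%:C h = 0 <->
  (forall j, (j.+3 <= n)%N -> h`_j = flat_ratio j * h`_j.+1).
Proof.
move=> h0.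
have hn0 j : (j.+1 < n)%N -> h`_j != 0.
  move=> hj; have hj' : (j < n.-1)%N by lia.
  by have := h0 (Ordinal hj'); rewrite (tnth_nth 0).
have H0 k : (1 <= k < n)%N -> hh h k != 0.
  by move=> hk; rewrite /hh fmorph_eq0 hn0 //; lia.
have q0 k : (1 <= k <= n)%N -> qint R n k != 0.
  by move=> hk; rewrite qint_real // fmorph_eq0 real_qint_neq0.
have qdet k : qint R n k.+1 ^+ 2 - qint R n k * qint R n k.+2 = 1.
  rewrite !qint_real // -(rmorphXn (real_complex R)) -rmorphM -rmorphB.
  by rewrite real_qint_det // rmorph1.
have qb0 : qint R n 0 = 0 by rewrite qint_real // real_qint0 rmorph0.
have qbn : qint R n n.+1 = 0 by rewrite qint_real // real_qintSn rmorph0.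
have s2C : s%:C ^+ 2 = 1 by rewrite -(rmorphXn (real_complex R)) s2 rmorph1.
have two0 : 2%:R != 0 :> R[i] by rewrite pnatr_eq0.
have main := scalar_eq0_iff qb0 qbn q0 qdet s2C H0 two0.
have tC k : alt_ratio (qint R n) s%:C k = (t k)%:C.
  rewrite /alt_ratio qint_real; move: (b k) => bk.
  rewrite -(rmorphN1 (real_complex R)) -(rmorphXn (real_complex R)).
  by rewrite fmorph_div rmorphM.
transitivity (forall j, (j.+3 <= n)%N ->
     hh h j.+1 / hh h j.+2 *
     ((1 - alt_ratio (qint R n) s%:C j.+2) /
      (1 + alt_ratio (qint R n) s%:C j.+2))
     = qint R n j.+1 / qint R n j.+2); last first.
  have E j : (j.+3 <= n)%N -> (hh h j.+1 / hh h j.+2 *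
     ((1 - alt_ratio (qint R n) s%:C j.+2) /
      (1 + alt_ratio (qint R n) s%:C j.+2))
     = qint R n j.+1 / qint R n j.+2) <-> h`_j = flat_ratio j * h`_j.+1.
    move=> hj; rewrite tC !qint_real // /hh /=.
    rewrite -[1]/(1%:C) -rmorphB -rmorphD -!fmorphV -!rmorphM.
    have /andP[tp tm] := alt_ratio_neq1 (real_qint_neq0 R n1)
      (real_qint_det R n1) s2 (k := j.+2) hj.
    have b1 : b j.+1 != 0 by apply: real_qint_neq0 => //; lia.
    have b2 : b j.+2 != 0 by apply: real_qint_neq0 => //; lia.
    have x1 : h`_j.+1 != 0 by apply: hn0.
    rewrite /flat_ratio; split => [/complexI E|->]; last first.
      congr (_%:C); by field; rewrite x1 b2 tp tm.
    rewrite -E; by field; rewrite x1 tp tm.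
  by split => H j hj; apply/(E j hj); apply: H.
rewrite -main; split => [S0 j hj|G].
  have := congr1 (fun f : A R n => f (Ordinal hj)) S0; rewrite ffunE.
  by rewrite (Ricci_scalar_label _ _ _ (j := j)).
apply/ffunP => v; rewrite ffunE (Ricci_scalar_label _ _ _ (j := val v)) //.
exact: (G (val v) (ltn_ord v)).
Qed.

(** The recursion [h_(j+2) = h_(j+1) / flat_ratio j] solved with [h_1 = 1]. *)
Definition flat_tuple : n.-1.-tuple R :=
  [tuple \prod_(k < i) (flat_ratio k)^-1 | i < n.-1].

Lemma flat_tuple_nth j : (j.+1 < n)%N ->
  flat_tuple`_j = \prod_(k < j) (flat_ratio k)^-1.
Proof.
move=> hj; have hj' : (j < n.-1)%N by lia.
by rewrite -(tnth_nth 0 _ (Ordinal hj')) tnth_mktuple.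
Qed.

Lemma flat_tuple_neq0 i : tnth flat_tuple i != 0.
Proof.
rewrite tnth_mktuple; apply/prodf_neq0 => k _.
rewrite invr_eq0 flat_ratio_neq0 //.
by have := ltn_ord k; have := ltn_ord i; lia.
Qed.

Lemma proportional_iff h : (forall i, tnth h i != 0) ->
  (forall j, (j.+3 <= n)%N -> h`_j = flat_ratio j * h`_j.+1) <->
  exists2 c : R, c != 0 & forall i, tnth h i = c * tnth flat_tuple i.
Proof.
move=> h0; split => [G|[c c0 hc] j hj].
  have hn : (0 < n.-1)%N by lia.
  (* [flat_tuple] starts with the empty product 1, so the scale is the first entry of [h]. *)
  exists h`_0; first by have := h0 (Ordinal hn); rewrite (tnth_nth 0).
  move=> i; rewrite tnth_mktuple (tnth_nth 0) /=.
  elim: {i}(val i) (ltn_ord i) => [|j IH] hj; first by rewrite big_ord0 mulr1.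
  rewrite big_ord_recr /= mulrA -IH ?(ltnW hj) // (G j); last by lia.
  by rewrite mulrAC divff ?mul1r // flat_ratio_neq0 //; lia.
have hcn k : (k.+1 < n)%N -> h`_k = c * flat_tuple`_k.
  move=> hk; have hk' : (k < n.-1)%N by lia.
  by have := hc (Ordinal hk'); rewrite !(tnth_nth 0).
rewrite !hcn ?(ltnW hj) // !flat_tuple_nth ?(ltnW hj) // big_ord_recr /=.
by field; apply: flat_ratio_neq0.
Qed.

End Solution.

Theorem mainTheorem6 (R : realType) (n : nat) (hn : (3 <= n)%N)
    (s : R[i]) (hs : s = 1 \/ s = -1) :
  exists h : n.-1.-tuple R,
    (forall i : 'I_n.-1, tnth h i != 0) /\
    (forall h' : n.-1.-tuple R,
       (forall i : 'I_n.-1, tnth h' i != 0) ->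
       (Ricci_scalar s h' = 0 <->
        exists2 c : R, c != 0 & forall i : 'I_n.-1, tnth h' i = c * tnth h i)).
Proof.
(* As [s] is real, so are all [tau_i] and hence the ratios of the solution. *)
have [sr [sr2 ->]] : exists sr : R, sr ^+ 2 = 1 /\ s = real_complex R sr.
  case: hs => ->; [exists 1 | exists (-1)]; rewrite ?sqrrN expr1n.
    by rewrite rmorph1.
  by rewrite rmorphN1.
exists (flat_tuple n sr); split=> [i|h' h'0]; first exact: flat_tuple_neq0.
by rewrite Ricci_scalar_eq0_iff // proportional_iff.
Qed.
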